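(* Let $E_1,\dots,E_n$ be $C^*$-correspondences over a $C^*$-algebra $\mathcal A$, let $\sigma:\mathcal A\to\mathcal B(\mathcal H)$ be a fixed nondegenerate $*$-representation on a Hilbert space $\mathcal H$, and for each $i\in I_n=\{1,\dots,n\}$ let $(\sigma,T_i)$ be an isometric covariant representation of $E_i$ on $\mathcal H$. Let $\mathcal H=\mathcal H_i^1\oplus\mathcal H_i^2$ be the (Muhly--Solel) Wold decomposition of $(\sigma,T_i)$, with $(\sigma,T_i)|_{\mathcal H_i^1}$ induced and $(\sigma,T_i)|_{\mathcal H_i^2}$ fully coisometric. The following are equivalent: (1) the family $(\sigma,T_1,\dots,T_n)$ admits a Wold decomposition; (2) for all $i,j\in I_n$, the subspace $\mathcal H_i^1$ reduces the covariant pair $(\sigma,T_j)$; (3) for all $i,j\in I_n$, the subspace $\mathcal H_i^2$ reduces the covariant pair $(\sigma,T_j)$.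
   Context: Hilbert spaces are complex and separable, inner products conjugate-linear in the first variable. A $C^*$-correspondence $E$ over $\mathcal A$ is a right Hilbert $\mathcal A$-module with a nondegenerate left action $\varphi:\mathcal A\to\mathcal L(E)$ (adjointable operators), $a\xi:=\varphi(a)\xi$, with $\overline{\mathrm{span}}\,\varphi(\mathcal A)E=E$. Tensor products of correspondences are balanced (interior) tensor products over $\mathcal A$; $E^0=\mathcal A$, $E^{n}=E\otimes_{\mathcal A}E^{n-1}$. For a nondegenerate representation $\sigma$ on $\mathcal H$, $E\otimes_\sigma\mathcal H$ is the Hilbert space completion of the algebraic tensor product with $\langle\xi\otimes h,\eta\otimes k\rangle=\langle h,\sigma(\langle\xi,\eta\rangle)k\rangle$. A (completely contractive) covariant representation of $E$ on $\mathcal H$ is a pair $(\sigma,T)$, $\sigma$ a nondegenerate representation of $\mathcal A$ and $T:E\to\mathcal B(\mathcal H)$ linear completely contractive with $T(a\xi b)=\sigma(a)T(\xi)\sigma(b)$. It induces a contraction $\widetilde T:E\otimes_\sigma\mathcal H\to\mathcal H$, $\widetilde T(\xi\otimes h)=T(\xi)h$. It is isometric if $T(\xi)^*T(\eta)=\sigma(\langle\xi,\eta\rangle)$ for all $\xi,\eta$ (equivalently $\widetilde T$ is an isometry), and fully coisometric if $\widetilde T\widetilde T^*=I_{\mathcal H}$. Put $\widetilde T^{(0)}(a\otimes h)=\sigma(a)h$ and $\widetilde T^{(l)}=\widetilde T(I_E\otimes\widetilde T^{(l-1)}):E^l\otimes_\sigma\mathcal H\to\mathcal H$. Induced representation: given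 a nondegenerate representation $\pi$ of $\mathcal A$ on $\mathcal K$, let $\mathcal F(E)=\bigoplus_{n\ge0}E^n$ with left action $\varphi_\infty$ (acting on the first tensor factor of each $E^n$, by left multiplication on $E^0$); the induced representation on $\mathcal F(E)\otimes_\pi\mathcal K$ is $\rho(a)=\varphi_\infty(a)\otimes I_{\mathcal K}$, $S(\xi)=T_\xi\otimes I_{\mathcal K}$ with $T_\xi\eta=\xi\otimes\eta$. A representation is called induced if it is unitarily equivalent to one of this form (the zero space is allowed). A closed subspace $\mathcal K\subseteq\mathcal H$ reduces $(\sigma,T)$ if $P_{\mathcal K}\in\sigma(\mathcal A)'$ and both $\mathcal K$ and $\mathcal K^\perp$ are invariant under all $T(\xi)$, $\xi\in E$. Muhly--Solel decomposition: for an isometric covariant representation $(\sigma,T)$ there is a unique orthogonal decomposition $\mathcal H=\mathcal H^1\oplus\mathcal H^2$ into reducing subspaces with $(\sigma,T)|_{\mathcal H^1}$ induced and $(\sigma,T)|_{\mathcal H^2}$ fully coisometric; explicitly $\mathcal H^1=\overline{\mathrm{span}}\{\widetilde T^{(n)}(\xi\otimes w):\xi\in E^n,\ w\in\mathrm{Ran}(I-\widetilde T\widetilde T^* ),\ n\ge0\}$ and $\mathcal H^2=\bigcap_{n\ge0}\widetilde T^{(n)}(E^n\otimes_\sigma\mathcal H)$. Wold decomposition of a family: $(\sigma,T_1,\dots,T_n)$ admits a Wold decomposition if for each $A\subseteq I_n$ there is a closed subspace $\mathcal H_A\subseteq\mathcal H$ (possibly trivial) such that $\mathcal H=\bigoplus_{A\subseteq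 I_n}\mathcal H_A$ (orthogonal sum), each $\mathcal H_A$ reduces $(\sigma,T_i)$ for all $i\in I_n$, and $(\sigma,T_i)|_{\mathcal H_A}$ is induced for $i\in A$ and $(\sigma,T_j)|_{\mathcal H_A}$ is fully coisometric for $j\in A^c=I_n\setminus A$. *)

(* Defs.v *)
From HB Require Import structures.
From mathcomp Require Import all_boot all_order all_algebra complex.
From mathcomp Require Import all_classical all_reals topology normedtype.

Set Implicit Arguments.
Unset Strict Implicit.
Unset Printing Implicit Defensive.

Import Order.TTheory GRing.Theory Num.Theory.
Import numFieldNormedType.Exports.

Local Open Scope classical_set_scope.
Local Open Scope ring_scope.

(* All spaces are complex: the scalars are R[i] for R : realType.  The norm of
   a normedModType R[i] takes its values in R[i], inside the nonnegative
   reals, so norms and inner products live in the same type. *)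

Section Spans.
Context {R : realType}.

Definition linear_span (V : lmodType R[i]) (S : set V) : set V :=
  [set v | exists (m : nat) (c : 'I_m -> R[i]) (x : 'I_m -> V),
    (forall i, S (x i)) /\ v = \sum_(i < m) c i *: x i].

Definition total_set (V : normedModType R[i]) (S : set V) : Prop :=
  closure (linear_span S) = setT.

Definition linear_map (V W : lmodType R[i]) (f : V -> W) : Prop :=
  forall c x y, f (c *: x + y) = c *: f x + f y.

Definition bounded_operator (V W : normedModType R[i]) (f : V -> W) : Prop :=
  linear_map f /\ continuous f.

Definition separable (V : topologicalType) : Prop :=
  exists2 D : set V, countable D & dense D.

End Spans.

(* Complex Hilbert spaces, not required to be separable here; the inner
   product is linear in the second variable. *)
HB.mixin Record isHilbert (R : realType) V of CompleteNormedModule R[i] V := {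
  inner : V -> V -> R[i];
  inner_linear : forall (x : V) c (y z : V),
    inner x (c *: y + z) = c * inner x y + inner x z;
  inner_conj : forall x y : V, inner y x = (inner x y)^*;
  inner_norm : forall x : V, inner x x = `|x| ^+ 2
}.

#[short(type="hilbertType")]
HB.structure Definition Hilbert (R : realType) :=
  {V of isHilbert R V & CompleteNormedModule R[i] V}.

(* C*-algebras, not assumed to have a unit; this is why the product is a field
   of the mixin and not the one of a ring structure. *)
HB.mixin Record isCStar (R : realType) A of CompleteNormedModule R[i] A := {
  cmul : A -> A -> A;
  cstar : A -> A;
  cmulA : forall a b c : A, cmul a (cmul b c) = cmul (cmul a b) c;
  cmul_linearl : forall (b : A) k (a a' : A),
    cmul (k *: a + a') b = k *: cmul a b + cmul a' b;
  cmul_linearr : forall (a : A) k (b b' : A),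
    cmul a (k *: b + b') = k *: cmul a b + cmul a b';
  cstarK : forall a : A, cstar (cstar a) = a;
  cstar_antilinear : forall k (a b : A),
    cstar (k *: a + b) = k^* *: cstar a + cstar b;
  cstarM : forall a b : A, cstar (cmul a b) = cmul (cstar b) (cstar a);
  cnormM : forall a b : A, `|cmul a b| <= `|a| * `|b|;
  cnorm_star : forall a : A, `|cmul (cstar a) a| = `|a| ^+ 2
}.

#[short(type="cstarType")]
HB.structure Definition CStar (R : realType) :=
  {A of isCStar R A & CompleteNormedModule R[i] A}.

(* A right Hilbert A-module with a left action of A by adjointable operators.
   A C*-correspondence is moreover required to have a nondegenerate left
   action; this is the separate predicate nondegenerate_action below, which
   the tensor powers of a C*-correspondence inherit.  An element of A is
   positive when it has the form b^* b. *)
HB.mixin Record isCorr (R : realType) (A : cstarType R) E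
    of CompleteNormedModule R[i] E := {
  ract : E -> A -> E;
  lact : A -> E -> E;
  cinner : E -> E -> A;
  ract_linearl : forall (a : A) k (x y : E),
    ract (k *: x + y) a = k *: ract x a + ract y a;
  ract_linearr : forall (x : E) k (a b : A),
    ract x (k *: a + b) = k *: ract x a + ract x b;
  ractM : forall (x : E) (a b : A), ract x (cmul a b) = ract (ract x a) b;
  cinner_linear : forall (x : E) k (y z : E),
    cinner x (k *: y + z) = k *: cinner x y + cinner x z;
  cinner_ract : forall (x y : E) (a : A), cinner x (ract y a) = cmul (cinner x y) a;
  cinner_star : forall x y : E, cinner y x = cstar (cinner x y);
  cinner_pos : forall x : E, exists b : A, cinner x x = cmul (cstar b) b;
  cinner_norm : forall x : E, `|x| ^+ 2 = `|cinner x x|;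
  lact_linearl : forall (x : E) k (a b : A),
    lact (k *: a + b) x = k *: lact a x + lact b x;
  lact_linearr : forall (a : A) k (x y : E),
    lact a (k *: x + y) = k *: lact a x + lact a y;
  lact_ract : forall (a b : A) (x : E), lact a (ract x b) = ract (lact a x) b;
  lactM : forall (a b : A) (x : E), lact (cmul a b) x = lact a (lact b x);
  lact_adjoint : forall (a : A) (x y : E),
    cinner (lact a x) y = cinner x (lact (cstar a) y)
}.

#[short(type="corrType")]
HB.structure Definition Corr (R : realType) (A : cstarType R) :=
  {E of isCorr R A E & CompleteNormedModule R[i] E}.

(* A as a correspondence over itself. *)
Definition regular (R : realType) (A : cstarType R) : Type := A.

Section Regular.
Context {R : realType} (A : cstarType R).

HB.instance Definition _ := CompleteNormedModule.copy (regular A) A.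

Let form0 (x y : regular A) : A := cmul (cstar (x : A)) (y : A).

Fact regular_form_star (x y : regular A) : form0 y x = cstar (form0 x y).
Proof. by rewrite /form0 cstarM cstarK. Qed.

Fact regular_form_norm (x : regular A) : `|x| ^+ 2 = `|form0 x x|.
Proof. by rewrite /form0 cnorm_star. Qed.

Fact regular_lact_adjoint (a : A) (x y : regular A) :
  form0 (cmul a (x : A)) y = form0 x (cmul (cstar a) (y : A)).
Proof. by rewrite /form0 cstarM cmulA. Qed.

HB.instance Definition _ := @isCorr.Build R A (regular A)
  (fun x a => cmul (x : A) a) (fun a x => cmul a (x : A)) form0
  (@cmul_linearl R A) (@cmul_linearr R A)
  (@cmulA R A) (fun x => @cmul_linearr R A (cstar (x : A)))
  (fun x y a => @cmulA R A (cstar (x : A)) y a)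
  regular_form_star (fun x => ex_intro _ (x : A) erefl) regular_form_norm
  (@cmul_linearl R A) (@cmul_linearr R A)
  (fun a b x => @cmulA R A a x b) (fun a b x => esym (@cmulA R A a b x))
  regular_lact_adjoint.

End Regular.

(* Closed subspaces of a Hilbert space, as Hilbert spaces in their own right. *)
Record csubspace (R : realType) (H : hilbertType R) := CSubspace {
  cset : set H;
  cset0 : cset 0;
  csetP : forall c x y, cset x -> cset y -> cset (c *: x + y);
  cset_closed : closed cset
}.

Record csub (R : realType) (H : hilbertType R) (K : csubspace H) := CSub {
  csub_val : H;
  csub_in : csub_val \in cset K
}.

Section SubHilbert.
Context {R : realType} (H : hilbertType R) (K : csubspace H).

HB.instance Definition _ := [isSub for @csub_val R H K].
HB.instance Definition _ := [Choice of csub K by <:].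

Fact csub_submod : submod_closed [in cset K].
Proof.
split; first by apply/mem_set/cset0.
by move=> c x y /set_mem Kx /set_mem Ky; apply/mem_set/csetP.
Qed.

HB.instance Definition _ :=
  GRing.SubChoice_isSubLmodule.Build R[i] H [in cset K] (csub K) csub_submod.

Let csub_norm (x : csub K) : R[i] := `|csub_val x|.

Fact csub_normD (x y : csub K) : csub_norm (x + y) <= csub_norm x + csub_norm y.
Proof. exact: ler_normD. Qed.

Fact csub_normZ (l : R[i]) (x : csub K) : csub_norm (l *: x) = `|l| * csub_norm x.
Proof. exact: normrZ. Qed.

Fact csub_norm0_eq0 (x : csub K) : csub_norm x = 0 -> x = 0.
Proof. by move=> /normr0_eq0 x0; apply: val_inj. Qed.

HB.instance Definition _ := Lmodule_isNormed.Build R[i] (csub K)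
  csub_normD csub_normZ csub_norm0_eq0.

Fact csub_complete (F : set_system (csub K)) :
  ProperFilter F -> cauchy F -> cvg F.
Proof.
move=> FF Fc; pose v := @csub_val R H K; pose G := v @ F.
have GF : ProperFilter G by exact: fmap_proper_filter.
have /cauchy_cvg/cvg_ex[/= l Gl] : cauchy G.
  apply: cauchy_exP => e e0.
  have /cauchyP/(_ e e0)[x Fx] := Fc.
  exists (v x); apply: filterS Fx => y.
  by rewrite -!ball_normE; apply.
have Kl : cset K l.
  apply: (@closed_cvg _ _ F FF v (cset K) (@cset_closed R H K) _ l Gl).
  by apply: nearW => x; exact: set_mem (csub_in x).
apply/cvg_ex; exists (CSub (mem_set Kl)).
apply/cvgrPdist_lt => e e0.
by move/cvgrPdist_lt: Gl => /(_ e e0).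
Qed.

HB.instance Definition _ := Uniform_isComplete.Build (csub K) csub_complete.

Let csub_inner (x y : csub K) : R[i] := inner (csub_val x) (csub_val y).

Fact csub_inner_linear (x : csub K) c (y z : csub K) :
  csub_inner x (c *: y + z) = c * csub_inner x y + csub_inner x z.
Proof. exact: inner_linear. Qed.

Fact csub_inner_conj (x y : csub K) : csub_inner y x = (csub_inner x y)^*.
Proof. exact: inner_conj. Qed.

Fact csub_inner_norm (x : csub K) : csub_inner x x = `|x| ^+ 2.
Proof. exact: inner_norm. Qed.

HB.instance Definition _ := isHilbert.Build R (csub K)
  csub_inner_linear csub_inner_conj csub_inner_norm.

End SubHilbert.

Section Covariant.
Context {R : realType} {A : cstarType R}.
Implicit Types (H K L X Y : hilbertType R) (E F G : corrType A).

(* [adjoint_pair f g] says that g is the adjoint f^* of f. *)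
Definition adjoint_pair H K (f : H -> K) (g : K -> H) : Prop :=
  forall x y, inner (f x) y = inner x (g y).

Definition unitary_map H K (U : H -> K) : Prop :=
  [/\ linear_map U, forall x y, inner (U x) (U y) = inner x y
    & forall y, exists x, U x = y].

Definition nondegenerate_action (V : normedModType R[i]) (act : A -> V -> V) : Prop :=
  total_set [set act a x | a in setT & x in setT].

Definition star_rep H (sigma : A -> H -> H) : Prop :=
  [/\ forall a, bounded_operator (sigma a),
      forall k a b h, sigma (k *: a + b) h = k *: sigma a h + sigma b h,
      forall a b h, sigma (cmul a b) h = sigma a (sigma b h)
    & forall a, adjoint_pair (sigma a) (sigma (cstar a))].

Definition nondegenerate_rep H (sigma : A -> H -> H) : Prop :=
  star_rep sigma /\ nondegenerate_action sigma.

(* The norm of a matrix xi in M_m(E) is its norm as an operator from the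
   Hilbert module A^m to E^m; a matrix over B(H) acts on H^m. *)
Definition completely_contractive E H (T : E -> H -> H) : Prop :=
  forall (m : nat) (xi : 'I_m -> 'I_m -> E) (c : R[i]), 0 <= c ->
  (forall a : 'I_m -> A,
    let xia i := \sum_(j < m) ract (xi i j) (a j) in
    `|\sum_(i < m) cinner (xia i) (xia i)|
      <= c ^+ 2 * `|\sum_(j < m) cmul (cstar (a j)) (a j)|) ->
  forall h : 'I_m -> H,
    \sum_(i < m) `|\sum_(j < m) T (xi i j) (h j)| ^+ 2
      <= c ^+ 2 * \sum_(j < m) `|h j| ^+ 2.

Definition covariant_rep E H (sigma : A -> H -> H) (T : E -> H -> H) : Prop :=
  [/\ nondegenerate_rep sigma,
      (forall xi, bounded_operator (T xi)) /\
      (forall k xi eta h, T (k *: xi + eta) h = k *: T xi h + T eta h),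
      completely_contractive T
    & forall a b xi h,
        T (ract (lact a xi) b) h = sigma a (T xi (sigma b h))].

Definition isometric_rep E H (sigma : A -> H -> H) (T : E -> H -> H) : Prop :=
  covariant_rep sigma T /\
  forall xi eta, exists2 Txi' : H -> H, adjoint_pair (T xi) Txi'
    & forall h, Txi' (T eta h) = sigma (cinner xi eta) h.

(* Interior tensor products are completions, hence only determined up to a
   unitary: the next two predicates say that the codomain of t, with the
   elementary tensors t x y, is such a completion. *)
Definition interior_tensor E F G (t : E -> F -> G) : Prop :=
  [/\ (forall y k x x', t (k *: x + x') y = k *: t x y + t x' y) /\
      (forall x k y y', t x (k *: y + y') = k *: t x y + t x y'),
      forall x a y, t (ract x a) y = t x (lact a y),
      (forall a x y, lact a (t x y) = t (lact a x) y) /\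
      (forall x y a, ract (t x y) a = t x (ract y a)),
      forall x y x' y', cinner (t x y) (t x' y') = cinner y (lact (cinner x x') y')
    & total_set [set t x y | x in setT & y in setT]].

Definition hilbert_tensor E H (sigma : A -> H -> H) Y (t : E -> H -> Y) : Prop :=
  [/\ (forall h k x x', t (k *: x + x') h = k *: t x h + t x' h) /\
      (forall x k h h', t x (k *: h + h') = k *: t x h + t x h'),
      forall x h y k, inner (t x h) (t y k) = inner h (sigma (cinner x y) k)
    & total_set [set t x h | x in setT & h in setT]].

(* In the definition below, Tt is the operator usually written T with a tilde,
   from the tensor product Y of E and H to H. *)
Definition fully_coisometric E H (sigma : A -> H -> H) (T : E -> H -> H) : Prop :=
  exists (Y : hilbertType R) (t : E -> H -> Y) (Tt : Y -> H) (Tt' : H -> Y),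
  [/\ hilbert_tensor sigma t, bounded_operator Tt,
      forall xi h, Tt (t xi h) = T xi h, adjoint_pair Tt Tt'
    & forall h, Tt (Tt' h) = h].

(* The tensor powers of E: E^0 is A, and P m is E^(m+1). *)
Definition tensor_power (P : nat -> corrType A) (m : nat) : corrType A :=
  if m is m'.+1 then P m' else regular A.

(* The full Fock module of E with its creation operators. *)
Record fock_module E := FockModule {
  fock_pow : nat -> corrType A;
  fock_tens : forall m,
    E -> tensor_power fock_pow m -> tensor_power fock_pow m.+1;
  fock_tensP : forall m, interior_tensor (@fock_tens m);
  fock :> corrType A;
  fock_inj : forall m, tensor_power fock_pow m -> fock;
  fock_inj_linear : forall m, linear_map (@fock_inj m);
  fock_inj_lact : forall m a x, @fock_inj m (lact a x) = lact a (fock_inj x);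
  fock_inj_ract : forall m x a, @fock_inj m (ract x a) = ract (fock_inj x) a;
  fock_inj_form : forall m (x y : tensor_power fock_pow m),
    cinner (fock_inj x) (fock_inj y) = cinner x y;
  fock_inj_orth : forall m p (x : tensor_power fock_pow m)
    (y : tensor_power fock_pow p), m != p -> cinner (fock_inj x) (fock_inj y) = 0;
  fock_total : total_set [set f | exists m x, f = @fock_inj m x];
  fock_create : E -> fock -> fock;
  fock_create_bounded : forall xi, bounded_operator (fock_create xi);
  fock_create_inj : forall xi m x,
    fock_create xi (@fock_inj m x) = fock_inj (fock_tens xi x)
}.

(* X is the tensor product of the Fock module and K, and (rho, S) is the
   representation induced by pi. *)
Definition induced_model E (F : fock_module E) K (pi : A -> K -> K)
    X (t : F -> K -> X) (rho : A -> X -> X) (S : E -> X -> X) : Prop :=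
  [/\ hilbert_tensor pi t,
      forall a, bounded_operator (rho a),
      forall xi, bounded_operator (S xi),
      forall a f k, rho a (t f k) = t (lact a f) k
    & forall xi f k, S xi (t f k) = t (fock_create xi f) k].

Definition induced E L (sigma : A -> L -> L) (T : E -> L -> L) : Prop :=
  exists (F : fock_module E) (K : hilbertType R) (pi : A -> K -> K)
    (X : hilbertType R) (t : F -> K -> X) (rho : A -> X -> X) (S : E -> X -> X)
    (U : X -> L),
  [/\ separable K /\ nondegenerate_rep pi, induced_model pi t rho S,
      unitary_map U,
      forall a x, U (rho a x) = sigma a (U x)
    & forall xi x, U (S xi x) = T xi (U x)].

Definition orthocomp H (S : set H) : set H :=
  [set h | forall k, S k -> inner k h = 0].

Definition orth_projection H (K : csubspace H) (P : H -> H) : Prop :=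
  forall h, cset K (P h) /\ orthocomp (cset K) (h - P h).

Definition reduces E H (sigma : A -> H -> H) (T : E -> H -> H)
    (K : csubspace H) : Prop :=
  [/\ exists2 P : H -> H, orth_projection K P
        & forall a h, P (sigma a h) = sigma a (P h),
      forall xi h, cset K h -> cset K (T xi h)
    & forall xi h, orthocomp (cset K) h -> orthocomp (cset K) (T xi h)].

(* Restriction of an operator to a closed subspace; the default value of
   insubd is only used where the subspace is not invariant. *)
Definition restr H (K : csubspace H) (f : H -> H) : csub K -> csub K :=
  fun x => insubd (0 : csub K) (f (csub_val x)).

Definition restr_induced E H (sigma : A -> H -> H) (T : E -> H -> H)
    (K : csubspace H) : Prop :=
  induced (fun a => restr (K := K) (sigma a)) (fun xi => restr (T xi)).

Definition restr_fully_coisometric E H (sigma : A -> H -> H) (T : E -> H -> H)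
    (K : csubspace H) : Prop :=
  fully_coisometric (fun a => restr (K := K) (sigma a)) (fun xi => restr (T xi)).

Definition muhly_solel_decomposition E H (sigma : A -> H -> H) (T : E -> H -> H)
    (H1 H2 : csubspace H) : Prop :=
  [/\ (forall x y, cset H1 x -> cset H2 y -> inner x y = 0) /\
      (forall h, exists x y, [/\ cset H1 x, cset H2 y & h = x + y]),
      reduces sigma T H1 /\ reduces sigma T H2,
      restr_induced sigma T H1
    & restr_fully_coisometric sigma T H2].

Definition orthogonal_sum H (I : finType) (K : I -> csubspace H) : Prop :=
  (forall i j x y, i != j -> cset (K i) x -> cset (K j) y -> inner x y = 0) /\
  (forall h, exists2 x : I -> H, forall i, cset (K i) (x i) & h = \sum_i x i).

Definition wold_decomposition n (E : 'I_n -> corrType A) H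
    (sigma : A -> H -> H) (T : forall i, E i -> H -> H) : Prop :=
  exists HA : {set 'I_n} -> csubspace H,
  [/\ orthogonal_sum HA,
      forall B i, reduces sigma (@T i) (HA B),
      forall (B : {set 'I_n}) i, i \in B -> restr_induced sigma (@T i) (HA B)
    & forall (B : {set 'I_n}) j, j \notin B ->
        restr_fully_coisometric sigma (@T j) (HA B)].

End Covariant.

(* Main.v *)
Require Import Defs.
From HB Require Import structures.
From mathcomp Require Import all_boot all_order all_algebra complex.
From mathcomp Require Import all_classical all_reals topology normedtype.
From mathcomp Require Import ring lra.

(* For an isometric representation T of E put D_0 = H and
   D_(m+1) = { T(xi) d : d in D_m }.  On a fully coisometric reducing subspace N
   the vectors T(xi) h are total, so N is orthogonal to D_m^perp for every m; an
   induced reducing subspace M is spanned by the images of the summands E^m of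
   the Fock module, and these lie in D_(m+1)^perp.  Hence M and N are
   orthogonal, and more generally G N is orthogonal to M for every self-adjoint
   G commuting with all T(xi).
     With G = 1 this shows that in a Wold decomposition H_B lies in H_i^1 if i is
   in B and in H_i^2 otherwise, so that H_i^1 is the sum of the H_B with i in B
   and reduces every T_j.  Conversely, if H_i^1 reduces T_j, then G may be the
   projection P_i onto H_i^1; this makes the P_i commute, and the joint ranges of
   the P_i (i in B) and 1 - P_i (i not in B) give the H_B.
     It remains to see that the two properties pass to a reducing subspace M of
   N.  A fully coisometric N only has to be tested on the vectors T(xi) h.  If N
   is induced from pi on K, an isometry u : K -> N identifies K with the vectors
   of N orthogonal to the range of T, and M is induced from the restriction of pi
   to { k : u k in M }. *)

Set Implicit Arguments.
Unset Strict Implicit.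
Unset Printing Implicit Defensive.

Import Order.TTheory GRing.Theory Num.Theory.
Import numFieldNormedType.Exports.

Local Open Scope classical_set_scope.
Local Open Scope ring_scope.

(** * Linear maps, spans and closures in normed spaces *)

Section LinearMaps.
Context {R : realType}.

Section Algebra.
Context (V W : lmodType R[i]) (f : V -> W) (fl : linear_map f).

Lemma lin0 : f 0 = 0.
Proof.
by have := fl (-1) 0 0; rewrite scaler0 add0r scaleN1r addNr.
Qed.

Lemma linD x y : f (x + y) = f x + f y.
Proof. by have := fl 1 x y; rewrite !scale1r. Qed.

Lemma linZ c x : f (c *: x) = c *: f x.
Proof. by have := fl c x 0; rewrite lin0 !addr0. Qed.

Lemma linN x : f (- x) = - f x.
Proof. by rewrite -scaleN1r linZ scaleN1r. Qed.

Lemma linB x y : f (x - y) = f x - f y.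
Proof. by rewrite linD linN. Qed.

Lemma lin_sum (I : finType) (F : I -> V) :
  f (\sum_i F i) = \sum_i f (F i).
Proof.
by apply: (big_morph f linD lin0).
Qed.

End Algebra.

Lemma linear_span_sub (V : lmodType R[i]) (S : set V) : S `<=` linear_span S.
Proof.
move=> x Sx; exists 1%N, (fun=> 1), (fun=> x); split=> //.
by rewrite big_ord1 scale1r.
Qed.

Lemma linear_span_lin (V : lmodType R[i]) (S : set V) c x y :
  linear_span S x -> linear_span S y -> linear_span S (c *: x + y).
Proof.
move=> [m [a [u [Su ->]]]] [p [b [v [Sv ->]]]].
exists (m + p)%N,
  (fun i => match fintype.split i with inl j => c * a j | inr j => b j end),
  (fun i => match fintype.split i with inl j => u j | inr j => v j end).
split; first by move=> i; case: fintype.split.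
rewrite big_split_ord /= scaler_sumr; congr (_ + _); apply: eq_bigr => j _.
  by rewrite -/(unsplit (inl j)) unsplitK scalerA.
by rewrite -/(unsplit (inr j)) unsplitK.
Qed.

Lemma linear_span_min (V : lmodType R[i]) (S P : set V) :
  P 0 -> (forall c x y, P x -> P y -> P (c *: x + y)) -> S `<=` P ->
  linear_span S `<=` P.
Proof.
move=> P0 Pl SP x [m [c [u [Su ->]]]].
elim/big_ind: _ => //.
  by move=> a b Pa Pb; rewrite -[a]scale1r; apply: Pl.
by move=> i _; rewrite -[_ *: _]addr0; apply: Pl => //; apply: SP.
Qed.

Lemma closureE_dist (V : normedModType R[i]) (S : set V) x :
  closure S x <-> forall e, 0 < e -> exists2 y, S y & `|x - y| < e.
Proof.
split=> [Sx e e0|Sx B /nbhs_ballP[e /= e0 eB]].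
  have [y [Sy]] := Sx _ (nbhsx_ballx x e e0).
  by rewrite -ball_normE => yx; exists y.
by have [y Sy xy] := Sx e e0; exists y; split=> //; apply: eB; rewrite -ball_normE.
Qed.

Lemma closed_dist (V : normedModType R[i]) (S : set V) :
  (forall x, (forall e, 0 < e -> exists2 y, S y & `|x - y| < e) -> S x) ->
  closed S.
Proof. by move=> h x Sx; apply/h/closureE_dist. Qed.

(** Density induction: a closed subspace containing [S] contains the closure of its span. Identities
    on tensor products are thereby reduced to elementary tensors. *)
Lemma total_ind (V : normedModType R[i]) (S P : set V) :
  total_set S -> closed P ->
  P 0 -> (forall c x y, P x -> P y -> P (c *: x + y)) -> S `<=` P ->
  forall x, P x.
Proof.
move=> St Pc P0 Pl SP x; apply: Pc.
have : closure (linear_span S) x by rewrite St.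
by apply: closure_subset; exact: linear_span_min.
Qed.

Lemma bounded_linear_cont (V W : normedModType R[i]) (f : V -> W) M :
  linear_map f -> (forall x, `|f x| <= M * `|x|) -> continuous f.
Proof.
move=> fl fM x; apply/cvgrPdist_lt => e e0.
(* [M] is any scalar of [R[i]]: the value 0 is treated apart, and otherwise [M] is replaced by its
   modulus before dividing. *)
have [M0|M0] := eqVneq M 0.
  by apply: nearW => y; rewrite -linB// (le_lt_trans (fM _))// M0 mul0r.
have normM y : `|f y| <= `|M| * `|y|.
  have := fM y; rewrite -[leRHS]ger0_norm ?normrM ?normr_id//.
  exact: le_trans (fM y).
have M1 : 0 < `|M| by rewrite normr_gt0.
apply/nbhs_ballP; exists (e / `|M|); first by rewrite /= divr_gt0.
move=> y; rewrite -ball_normE /= => xy; rewrite -linB//.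
by rewrite (le_lt_trans (normM _))// mulrC -ltr_pdivlMr.
Qed.

Lemma closed_preimage_cont (V W : topologicalType) (f : V -> W) (D : set W) :
  continuous f -> closed D -> closed (f @^-1` D).
Proof. by move=> /continuous_closedP; apply. Qed.

Lemma closed_eq0 (V W : normedModType R[i]) (f : V -> W) :
  continuous f -> closed [set x | f x = 0].
Proof.
move=> fc; apply: (closed_preimage_cont (D := [set 0]) fc).
by apply: accessible_closed_set1; apply: hausdorff_accessible; exact: norm_hausdorff.
Qed.

End LinearMaps.

(** * Inner products, Cauchy-Schwarz and orthogonality *)

Section InnerProduct.
Context {R : realType}.
Implicit Types (H K V W : hilbertType R).

Section Algebra.
Context (H : hilbertType R).
Implicit Types (x y z : H).

Lemma inner_linear_map x : linear_map (W := R[i]^o) (inner x).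
Proof. by move=> c y z; rewrite inner_linear. Qed.

Lemma inner0r x : inner x 0 = 0. Proof. exact: (lin0 (inner_linear_map x)). Qed.
Lemma innerDr x y z : inner x (y + z) = inner x y + inner x z.
Proof. exact: (linD (inner_linear_map x)). Qed.
Lemma innerBr x y z : inner x (y - z) = inner x y - inner x z.
Proof. exact: (linB (inner_linear_map x)). Qed.
Lemma innerZr x c y : inner x (c *: y) = c * inner x y.
Proof. exact: (linZ (inner_linear_map x)). Qed.
Lemma inner_sumr x (I : finType) (F : I -> H) :
  inner x (\sum_i F i) = \sum_i inner x (F i).
Proof. exact: (lin_sum (inner_linear_map x)). Qed.
Lemma inner0l x : inner 0 x = 0. Proof. by rewrite inner_conj inner0r conjC0. Qed.
Lemma innerDl x y z : inner (x + y) z = inner x z + inner y z.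
Proof. by rewrite inner_conj innerDr rmorphD /= -!inner_conj. Qed.
Lemma innerBl x y z : inner (x - y) z = inner x z - inner y z.
Proof. by rewrite inner_conj innerBr rmorphB /= -!inner_conj. Qed.
Lemma innerZl c x y : inner (c *: x) y = c^* * inner x y.
Proof. by rewrite inner_conj innerZr rmorphM /= -!inner_conj. Qed.

Lemma inner_eq0C x y : inner x y = 0 -> inner y x = 0.
Proof. by move=> xy; rewrite inner_conj xy conjC0. Qed.

Lemma inner_self_eq0 x : inner x x = 0 -> x = 0.
Proof.
by rewrite inner_norm => /eqP; rewrite sqrf_eq0 normr_eq0 => /eqP.
Qed.

Lemma Cauchy_Schwarz x y : `|inner x y| <= `|x| * `|y|.
Proof.
have [->|y0] := eqVneq y 0; first by rewrite inner0r !normr0 mulr0.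
have n0 : `|y| != 0 by rewrite normr_eq0.
have nR : (`|y|)^* = `|y| by apply: conj_Creal; exact: normr_real.
(* [c *: y] is the projection of [x] onto the line of [y]; expanding the squared norm of
   [x - c *: y] gives the inequality. *)
pose c := inner y x / `|y| ^+ 2.
have cC : c^* = inner x y / `|y| ^+ 2.
  by rewrite /c rmorphM /= -inner_conj fmorphV /= rmorphXn /= nR.
have : 0 <= inner (x - c *: y) (x - c *: y) by rewrite inner_norm exprn_ge0.
rewrite innerBl !innerBr !innerZl !innerZr !inner_norm cC /c (inner_conj x y).
set a := inner x y; set N := `|y|.
have -> : `|x| ^+ 2 - a^* / N ^+ 2 * a -
   (a / N ^+ 2 * a^* - a / N ^+ 2 * (a^* / N ^+ 2 * N ^+ 2)) =
   `|x| ^+ 2 - a * a^* / N ^+ 2 by field.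
rewrite -normCK subr_ge0 ler_pdivrMr; last by rewrite exprn_gt0// lt0r n0 normr_ge0.
by rewrite -exprMn ler_pXn2r ?nnegrE ?mulr_ge0 ?normr_ge0.
Qed.

Lemma inner_cont x : continuous (inner x : H -> R[i]^o).
Proof.
apply: (bounded_linear_cont (M := `|x|)); first exact: inner_linear_map.
by move=> y; exact: Cauchy_Schwarz.
Qed.

Lemma parallelogram x y :
  `|x + y| ^+ 2 + `|x - y| ^+ 2 = 2 * `|x| ^+ 2 + 2 * `|y| ^+ 2.
Proof.
rewrite -!inner_norm innerBl !innerBr innerDl !innerDr.
ring.
Qed.

End Algebra.

Lemma closed_orthr H (x : H) : closed [set y | inner x y = 0].
Proof. exact: (closed_eq0 (@inner_cont H x)). Qed.

Lemma closed_orthl H (x : H) : closed [set y | inner y x = 0].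
Proof.
rewrite (_ : [set _ | _] = [set y | inner x y = 0]); first exact: closed_orthr.
by apply/seteqP; split=> y /=; exact: inner_eq0C.
Qed.

Lemma total_orth H (S : set H) x :
  total_set S -> (forall s, S s -> inner s x = 0) -> x = 0.
Proof.
move=> St Sx; apply: inner_self_eq0.
apply: (total_ind (P := [set y | inner y x = 0]) St) => //.
- exact: closed_orthl.
- by rewrite /= inner0l.
- by move=> c y z /= yx zx; rewrite innerDl innerZl yx zx mulr0 addr0.
Qed.

Lemma orthocomp_set H (S : set H) : closed (orthocomp S).
Proof.
rewrite (_ : orthocomp S = \bigcap_(k in S) [set h | inner k h = 0]).
  by apply: closed_bigI => k _; exact: closed_orthr.
by apply/seteqP; split=> h.
Qed.

Definition orthoc H (S : set H) : csubspace H.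
Proof.
refine (@CSubspace _ _ (orthocomp S) _ _ (@orthocomp_set H S)).
  by move=> k _; rewrite inner0r.
by move=> c x y hx hy k Sk; rewrite innerDr innerZr hx// hy// mulr0 addr0.
Defined.

End InnerProduct.

(** * Existence of the orthogonal projection of a point *)

Section Projection.
Context {R : realType}.
Implicit Types (H K V W : hilbertType R).

Lemma ReK (z : R[i]) : 0 <= z -> (complex.Re z)%:C%C = z.
Proof. by move=> z0; apply: RRe_real; exact: ger0_real. Qed.

Lemma posRe (z : R[i]) : 0 < z -> 0 < complex.Re z.
Proof. by move=> z0; rewrite -ltcR ReK// ltW. Qed.

Lemma csetD H (K : csubspace H) x y : cset K x -> cset K y -> cset K (x + y).
Proof. by move=> Kx Ky; rewrite -[x]scale1r; apply: csetP. Qed.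

Lemma csetZ H (K : csubspace H) c x : cset K x -> cset K (c *: x).
Proof. by move=> Kx; rewrite -[_ *: _]addr0; apply: csetP => //; exact: cset0. Qed.

Lemma csetB H (K : csubspace H) x y : cset K x -> cset K y -> cset K (x - y).
Proof.
by move=> Kx Ky; apply: csetD => //; rewrite -scaleN1r; exact: csetZ.
Qed.

Lemma cset_sum H (K : csubspace H) (I : finType) (P : pred I) (F : I -> H) :
  (forall i, P i -> cset K (F i)) -> cset K (\sum_(i | P i) F i).
Proof. by move=> KF; elim/big_ind: _ => //; [exact: cset0 | exact: csetD]. Qed.

(** The point is the limit of the filter of almost nearest points of [K], which the parallelogram
    law makes Cauchy. *)
Lemma projection_point H (K : csubspace H) (h : H) :
  exists p, cset K p /\ orthocomp (cset K) (h - p).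
Proof.
(* The squared distance is taken in [R], where infima exist; [qE] brings it back to [R[i]], where
   norms live. *)
pose q k : R := complex.Re (`|h - k| ^+ 2).
have qE k : (q k)%:C%C = `|h - k| ^+ 2 by rewrite ReK// exprn_ge0.
have q0 k : 0 <= q k by rewrite -lecR qE exprn_ge0.
pose D := q @` cset K.
have Dinf : has_inf D.
  by split; [exists (q 0), 0 => //; exact: cset0 | exists 0 => _ [k _ <-]].
pose d := inf D.
have dq k : cset K k -> d <= q k.
  by move=> Kk; apply: ge_inf; [case: Dinf | exists k].
pose B (e : R) := [set k | cset K k /\ q k < d + e].
have B0 e : 0 < e -> B e !=set0.
  by move=> e0; have [_ [k Kk <-] qe] := inf_adherent e0 Dinf; exists k.
pose F := filter_from [set e : R | 0 < e] B.
have FF : ProperFilter F.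
  apply: filter_from_proper => //; apply: filter_from_filter.
    by exists 1; exact: ltr01.
  move=> e e' e0 e'0; exists (Num.min e e'); first by rewrite /= lt_min e0.
  move=> k [Kk]; rewrite -ltrBlDl lt_min => /andP[ke ke'].
  by split; split=> //; rewrite -ltrBlDl.
have Bdist e k k' : B e k -> B e k' -> `|k - k'| ^+ 2 <= (4 * e)%:C%C.
  move=> [Kk ke] [Kk' ke'].
  (* The midpoint lies in [K], so [d <= q m]; the parallelogram law then bounds the squared distance
     of [k] and [k'] by [4 * e]. *)
  pose m := 2^-1 *: (k + k').
  have Km : cset K m.
    by apply/csetZ/csetD.
  have := parallelogram (h - k) (h - k').
  have -> : h - k + (h - k') = 2 *: (h - m).
    rewrite scalerBr /m scalerA divff ?pnatr_eq0// scale1r.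
    by rewrite scaler_nat mulr2n opprD addrACA.
  have -> : h - k - (h - k') = k' - k by rewrite opprB addrC addrA subrK.
  rewrite normrZ exprMn normr_nat (distrC k') => par.
  have -> : `|k - k'| ^+ 2 = (2 * q k + 2 * q k' - 4 * q m)%:C%C.
    rewrite rmorphB rmorphD !rmorphM !rmorph_nat /= !qE -par; ring.
  by rewrite lecR; have := dq _ Km; lra.
have Fc : cauchy F.
  apply: cauchy_exP => e e0.
  (* With this choice [4 * e'] is half the square of [e]. *)
  pose e' := complex.Re e ^+ 2 / 8.
  have r0 := posRe e0.
  have e'0 : 0 < e' by rewrite divr_gt0// exprn_gt0.
  have [k Bk] := B0 _ e'0; exists k; exists e' => // k' Bk'.
  rewrite -ball_normE /=.
  rewrite -(@ltr_pXn2r _ 2) ?nnegrE ?(ltW e0)//.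
  apply: le_lt_trans (Bdist _ _ _ Bk Bk') _.
  rewrite -(ReK (ltW e0)) -rmorphXn ltcR /e'.
  have : 0 < complex.Re e ^+ 2 by rewrite exprn_gt0.
  by lra.
have /cvg_ex[/= p Fp] := @cauchy_cvg _ F FF Fc.
have FK : F (cset K) by exists 1; [exact: ltr01 | move=> k []].
exists p; split.
  apply: (@closed_cvg _ _ F FF id (cset K) (@cset_closed R H K) _ p Fp).
  exact: FK.
move=> v Kv.
pose z k : R[i]^o := inner v (h - k).
have zB e k : B e k -> `|z k| ^+ 2 <= e%:C%C * `|v| ^+ 2.
  move=> [Kk ke].
  have [v0|v0] := eqVneq v 0; first by rewrite /z v0 inner0l !normr0 expr0n mulr0.
  pose N := `|v| ^+ 2.
  have N0 : 0 < N by rewrite exprn_gt0// normr_gt0.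
  have NC : N^* = N by apply: conj_Creal; exact: gtr0_real.
  (* Moving from [k] to [k + c *: v] lowers the squared distance by [|z k|^2 / N]; as [q k < d + e]
     and no value is below [d], this drop is at most [e]. *)
  pose c := z k / N.
  have := dq _ (csetD Kk (csetZ c Kv)).
  have qk : q k <= d + e by exact: ltW.
  rewrite -lecR qE opprD addrA -inner_norm.
  move: (qE k) (erefl (z k)); rewrite {2}/z; move: (h - k) => g gE zE.
  rewrite innerBl !innerBr !innerZl !innerZr !inner_norm -gE -/N.
  rewrite (inner_conj v g) -zE /c rmorphM fmorphV /= NC.
  move=> dle.
  have : d%:C%C <= (q k)%:C%C - z k * (z k)^* / N.
    apply: le_trans dle _; rewrite le_eqVlt; apply/orP; left; apply/eqP.
    by field; rewrite gt_eqF.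
  move: qk; rewrite -lecR rmorphD /= => qk.
  rewrite -normCK => dle'.
  rewrite -ler_pdivrMr//.
  by rewrite -(lerD2l d%:C%C); apply: le_trans qk; rewrite -lerBrDr.
have z0 : z @ F --> (0 : R[i]^o).
  apply/cvgrPdist_lt => e e0.
  pose s := complex.Re (`|v| ^+ 2).
  have sE : s%:C%C = `|v| ^+ 2 by rewrite ReK// exprn_ge0.
  have s0 : 0 <= s by rewrite -lecR sE exprn_ge0.
  (* The summand 1 keeps the denominator positive when [v] is 0. *)
  pose e' := complex.Re e ^+ 2 / (s + 1).
  have r0 : 0 < complex.Re e ^+ 2 by rewrite exprn_gt0// posRe.
  have s1 : 0 < s + 1 by rewrite ltr_wpDl.
  exists e'; first by rewrite /= divr_gt0.
  move=> k Bk /=; rewrite sub0r normrN.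
  rewrite -(@ltr_pXn2r _ 2) ?nnegrE ?(ltW e0)//.
  apply: le_lt_trans (zB _ _ Bk) _.
  rewrite -sE -(ReK (ltW e0)) -rmorphXn -rmorphM ltcR /e' mulrAC ltr_pdivrMr//.
  nra.
have zp : z @ F --> (z p : R[i]^o).
  have zc : continuous z.
    move=> k; rewrite /z.
    apply: (continuous_comp (f := fun k => h - k) (g := inner v : H -> R[i]^o)).
      by apply: continuousB; [exact: cst_continuous | exact: cvg_id].
    exact: inner_cont.
  exact: (cvg_trans (cvg_app z Fp) (zc p)).
exact: (@cvg_unique _ (@norm_hausdorff _ R[i]^o) (z @ F) _ _ _ zp z0).
Qed.

End Projection.

(** * Properties of projections, totality and polarization *)

Section ProjectionTheory.
Context {R : realType}.
Implicit Types (H K V W : hilbertType R).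

Lemma orth_projection_exists H (K : csubspace H) :
  exists P, orth_projection K P.
Proof. by have [P] := choice (projection_point K); exists P. Qed.

Lemma orthocomp_self H (S : set H) x : S x -> orthocomp S x -> x = 0.
Proof. by move=> Sx /(_ _ Sx); exact: inner_self_eq0. Qed.

Section Projection.
Context H (K : csubspace H) (P : H -> H) (PP : orth_projection K P).

Lemma proj_in h : cset K (P h). Proof. by case: (PP h). Qed.

Lemma proj_orth h k : cset K k -> inner k (h - P h) = 0.
Proof. by case: (PP h) => _; apply. Qed.

Lemma proj_uniq h p : cset K p -> orthocomp (cset K) (h - p) -> P h = p.
Proof.
move=> Kp hp; apply/subr0_eq; apply: (@orthocomp_self _ (cset K)).
  by apply: csetB => //; exact: proj_in.
move=> k Kk; have -> : P h - p = (h - p) - (h - P h).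
  by rewrite opprB [RHS]addrC addrA subrK.
by rewrite innerBr hp// proj_orth// subrr.
Qed.

Lemma proj_id h : cset K h -> P h = h.
Proof.
by move=> Kh; apply: proj_uniq => // k _; rewrite subrr inner0r.
Qed.

Lemma proj_linear : linear_map P.
Proof.
move=> c x y; apply: proj_uniq; first by apply: csetP; exact: proj_in.
move=> k Kk; rewrite opprD addrACA -scalerBr innerDr innerZr.
by rewrite !proj_orth// mulr0 addr0.
Qed.

Lemma proj_sym x y : inner (P x) y = inner x (P y).
Proof.
have e1 : inner (P x) y = inner (P x) (P y).
  by apply/subr0_eq; rewrite -innerBr proj_orth//; exact: proj_in.
rewrite e1; apply/esym/subr0_eq; rewrite -innerBl; apply: inner_eq0C.
by rewrite proj_orth//; exact: proj_in.
Qed.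

Lemma proj_norm x : `|P x| <= `|x|.
Proof.
have [->|Px0] := eqVneq (P x) 0; first by rewrite normr0.
have : `|P x| ^+ 2 <= `|x| * `|P x|.
  have E : inner x (P x) = `|P x| ^+ 2.
    by rewrite -inner_norm proj_sym (proj_id (proj_in _)).
  by rewrite -[X in X <= _]ger0_norm ?exprn_ge0// -E; exact: Cauchy_Schwarz.
by rewrite expr2 ler_pM2r// normr_gt0.
Qed.

Lemma proj_commute (f : H -> H) : linear_map f ->
  (forall h, cset K h -> cset K (f h)) ->
  (forall h, orthocomp (cset K) h -> orthocomp (cset K) (f h)) ->
  forall h, P (f h) = f (P h).
Proof.
move=> fl fK fK' h; apply: proj_uniq; first by apply: fK; exact: proj_in.
by rewrite -(linB fl); apply: fK' => k; exact: proj_orth.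
Qed.

End Projection.

Lemma closure_span_lin (V : normedModType R[i]) (S : set V) c x y :
  closure (linear_span S) x -> closure (linear_span S) y ->
  closure (linear_span S) (c *: x + y).
Proof.
move=> /closureE_dist Sx /closureE_dist Sy; apply/closureE_dist => e e0.
have c1 : 0 < `|c| + 1 by rewrite ltr_wpDl.
have [x' Sx' xx'] := Sx (e / 2 / (`|c| + 1)) ltac:(by rewrite !divr_gt0).
have [y' Sy' yy'] := Sy (e / 2) ltac:(by rewrite divr_gt0).
exists (c *: x' + y'); first exact: linear_span_lin.
rewrite opprD addrACA -scalerBr (le_lt_trans (ler_normD _ _))//.
rewrite [e]splitr ltr_leD//; last exact: ltW.
rewrite normrZ; apply: le_lt_trans (_ : (`|c| + 1) * `|x - x'| < _).
  by rewrite ler_wpM2r// lerDl.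
by rewrite mulrC -ltr_pdivlMr.
Qed.

Definition cspan H (S : set H) : csubspace H.
Proof.
refine (@CSubspace _ _ (closure (linear_span S)) _ _ _).
- apply: subset_closure; exists 0%N, (fun=> 0), (fun=> 0).
  by split=> [[]//|]; rewrite big_ord0.
- exact: closure_span_lin.
- exact: closed_closure.
Defined.

(** Projecting [h] onto the closed span leaves a remainder orthogonal to [S]. With [total_orth],
    totality becomes a statement about orthogonality. *)
Lemma total_of_orth H (S : set H) :
  (forall x, (forall s, S s -> inner s x = 0) -> x = 0) -> total_set S.
Proof.
move=> S0; apply/seteqP; split=> // h _.
have [p [Sp hp]] := projection_point (cspan S) h.
have -> : h = p.
  apply/subr0_eq/S0 => s Ss; apply: hp.
  by apply: subset_closure; exact: linear_span_sub.
exact: Sp.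
Qed.

Lemma polarization V W (u : V -> W) : linear_map u ->
  (forall x, `|u x| = `|x|) -> forall x y, inner (u x) (u y) = inner x y.
Proof.
move=> ul un x y.
have E c : inner (c *: u x + u y) (c *: u x + u y) =
           inner (c *: x + y) (c *: x + y).
  by rewrite -ul !inner_norm un.
have D c : c^* * inner (u x) (u y) + c * inner (u y) (u x) =
           c^* * inner x y + c * inner y x.
  have := E c; rewrite !innerDl !innerDr !innerZl !innerZr !inner_norm !un.
  move=> /eqP; rewrite -!addrA (inj_eq (addrI _)) !addrA.
  by rewrite (inj_eq (addIr _)) => /eqP.
(* [D 1] determines the sum of the two mutually conjugate inner products and [D 'i] their
   difference. *)
have := D 1; have := D 'i; rewrite conjC1 conjCi !mul1r.
move: (inner (u x) (u y)) (inner (u y) (u x)) (inner x y) (inner y x).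
move=> a b a' b' Di D1.
have iN0 : - 'i != 0 :> R[i] by rewrite oppr_eq0 neq0Ci.
have E2 : a - b = a' - b'.
  apply: (mulfI iN0); transitivity (- 'i * a + 'i * b); first by ring.
  by rewrite Di; ring.
have -> : a = ((a + b) + (a - b)) / 2 by field.
by rewrite D1 E2; field.
Qed.

End ProjectionTheory.

(** * Extension of Gram-preserving maps, and separability of subspaces *)

Section Extension.
Context {R : realType}.
Implicit Types (H K V W : hilbertType R).

Section Isometry.
Context V W (I : Type) (s : I -> V) (y : I -> W).
Hypothesis s_total : total_set (range s).
Hypothesis gram : forall i j, inner (s i) (s j) = inner (y i) (y j).

(** A relation instead of a map, since a vector may be a combination of the [s i] in several ways.
    Equality of the Gram matrices makes it preserve norms. *)
Let graph (v : V) (w : W) := exists (m : nat) (c : 'I_m -> R[i]) (k : 'I_m -> I),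
  v = \sum_i c i *: s (k i) /\ w = \sum_i c i *: y (k i).

Let graph_span v : linear_span (range s) v -> exists w, graph v w.
Proof.
move=> [m [c [x [sx ->]]]].
have /choice[k kE] : forall i, exists j, s j = x i.
  by move=> i; have [j _ <-] := sx i; exists j.
exists (\sum_i c i *: y (k i)), m, c, k; split=> //.
by apply: eq_bigr => i _; rewrite kE.
Qed.

Let graph_lin c v w v' w' : graph v w -> graph v' w' ->
  graph (c *: v + v') (c *: w + w').
Proof.
move=> [m [a [k [-> ->]]]] [p [b [l [-> ->]]]].
exists (m + p)%N,
  (fun i => match fintype.split i with inl j => c * a j | inr j => b j end),
  (fun i => match fintype.split i with inl j => k j | inr j => l j end).
rewrite !big_split_ord /= !scaler_sumr; split; congr (_ + _); apply: eq_bigr => j _;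
  rewrite -?/(unsplit (inl j)) -?/(unsplit (inr j)) ?unsplitK ?scalerA//.
Qed.

Let graph_norm v w : graph v w -> `|v| = `|w|.
Proof.
move=> [m [c [k [vE wE]]]].
have : `|v| ^+ 2 = `|w| ^+ 2.
  rewrite -!inner_norm {1}vE {1}wE.
  rewrite [inner _ v]inner_conj [inner _ w]inner_conj !inner_sumr; congr (_^*).
  apply: eq_bigr => i _; rewrite !innerZr; congr (_ * _).
  rewrite vE wE inner_conj [RHS]inner_conj !inner_sumr; congr (_^*).
  by apply: eq_bigr => j _; rewrite !innerZr gram.
by move/eqP; rewrite eqrXn2// => /eqP.
Qed.

(** The closure of [graph]: completeness of [W] gives every [v] a value, and preservation of norms
    makes the value unique. *)
Let limgraph v w := forall e, 0 < e ->
  exists v' w', [/\ graph v' w', `|v - v'| < e & `|w - w'| < e].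

Let limgraph_total v : exists w, limgraph v w.
Proof.
pose B e := [set w | exists2 v', graph v' w & `|v - v'| < e].
have B0 e : 0 < e -> B e !=set0.
  move=> e0; have : closure (linear_span (range s)) v by rewrite s_total.
  move=> /closureE_dist/(_ e e0)[v' /graph_span[w vw] vv'].
  by exists w, v'.
pose F := filter_from [set e : R[i] | 0 < e] B.
have FF : ProperFilter F.
  apply: filter_from_proper => //; apply: filter_from_filter.
    by exists 1; exact: ltr01.
  move=> e e' /= e0 e'0.
  have /orP ee' : (e <= e') || (e' <= e) by apply: real_leVge; exact: gtr0_real.
  have [h|h] := ee'.
    exists e => // w [v' vw vv']; split; exists v' => //; exact: lt_le_trans h.
  exists e' => // w [v' vw vv']; split; exists v' => //; exact: lt_le_trans h.
have Bdist e w w' : B e w -> B e w' -> `|w - w'| < e + e.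
  move=> [v1 v1w vv1] [v2 v2w vv2].
  have g : graph (v1 - v2) (w - w').
    rewrite -scaleN1r addrC -[w - _]addrC -(scaleN1r w').
    exact: graph_lin.
  rewrite -(graph_norm g).
  have -> : v1 - v2 = (v - v2) - (v - v1) by rewrite opprB [RHS]addrC addrA subrK.
  by rewrite (le_lt_trans (ler_normB _ _))// ltrD.
have Fc : cauchy F.
  apply: cauchy_exP => e e0.
  have e20 : 0 < e / 2 by rewrite divr_gt0.
  have [w Bw] := B0 _ e20; exists w; exists (e / 2) => // w' Bw'.
  by rewrite -ball_normE /= [e]splitr; apply: Bdist.
have /cvg_ex[/= w Fw] := @cauchy_cvg _ F FF Fc.
exists w => e e0.
have FB : F (ball w e) by apply: Fw; exact: nbhsx_ballx.
have FBe : F (B e) by exists e.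
have [w' [ww' [v' v'w' vv']]] := filter_ex (filterI FB FBe).
by exists v', w'; split=> //; move: ww'; rewrite -ball_normE.
Qed.

Let limgraph_lin c v w v' w' : limgraph v w -> limgraph v' w' ->
  limgraph (c *: v + v') (c *: w + w').
Proof.
move=> vw vw' e e0.
have c1 : 0 < `|c| + 1 by rewrite ltr_wpDl.
have [v1 [w1 [g1 vv1 ww1]]] := vw (e / 2 / (`|c| + 1)) ltac:(by rewrite !divr_gt0).
have [v2 [w2 [g2 vv2 ww2]]] := vw' (e / 2) ltac:(by rewrite divr_gt0).
have est (X : normedModType R[i]) (a a' b b' : X) :
    `|a - a'| < e / 2 / (`|c| + 1) -> `|b - b'| < e / 2 ->
    `|c *: a + b - (c *: a' + b')| < e.
  move=> aa' bb'.
  rewrite opprD addrACA -scalerBr (le_lt_trans (ler_normD _ _))//.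
  rewrite [e]splitr ltr_leD//; last exact: ltW.
  rewrite normrZ; apply: le_lt_trans (_ : (`|c| + 1) * `|a - a'| < _).
    by rewrite ler_wpM2r// lerDl.
  by rewrite mulrC -ltr_pdivlMr.
exists (c *: v1 + v2), (c *: w1 + w2); split; [exact: graph_lin | exact: est..].
Qed.

Let limgraph_norm v w : limgraph v w -> `|w| = `|v|.
Proof.
have near (X : normedModType R[i]) (a a' : X) d : `|a - a'| < d -> `|a| <= `|a'| + d.
  move=> /ltW aa'; rewrite -{1}(subrK a' a) addrC.
  by apply: le_trans (ler_normD _ _) _; rewrite lerD2l.
move=> vw; apply/le_anti/andP; split; apply/ler_addgt0Pr => e e0;
  have [v' [w' [g vv' ww']]] := vw (e / 2) ltac:(by rewrite divr_gt0);
  have gn := graph_norm g; rewrite [e]splitr addrA.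
  by apply: le_trans (near _ _ _ _ ww') _; rewrite -gn lerD2r near// distrC.
by apply: le_trans (near _ _ _ _ vv') _; rewrite gn lerD2r near// distrC.
Qed.

Lemma isometric_extension : exists u : V -> W,
  [/\ linear_map u, forall a b, inner (u a) (u b) = inner a b
    & forall i, u (s i) = y i].
Proof.
have [u uP] := choice limgraph_total.
have uE v w : limgraph v w -> u v = w.
  move=> vw; apply/subr0_eq/normr0_eq0.
  (* The difference of two values at [v] is a value at 0, so its norm is 0. *)
  have := limgraph_lin (-1) vw (uP v).
  by rewrite !scaleN1r addNr addrC => /limgraph_norm; rewrite normr0.
have ul : linear_map u by move=> c a b; apply: uE; exact: limgraph_lin.
exists u; split=> //.
  by apply: polarization => // v; apply: limgraph_norm.
move=> i; apply: uE => e e0; exists (s i), (y i).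
rewrite !subrr !normr0; split=> //.
by exists 1%N, (fun=> 1), (fun=> i); rewrite !big_ord1 !scale1r.
Qed.

End Isometry.

(** The projection is a contraction fixing [M], so it carries a countable dense set to one dense in
    [M]. *)
Lemma separable_csub K (M : csubspace K) : separable K -> separable (csub M).
Proof.
move=> [D Dc Dd]; have [P PP] := orth_projection_exists M.
pose p k : csub M := CSub (mem_set (proj_in PP k)).
exists (p @` D); first exact: sub_countable (card_image_le _ _) Dc.
move=> O [x Ox] Oo.
have /nbhs_ballP[e /= e0 eO] : nbhs x O by exact: open_nbhs_nbhs.
have [d [xd Dd']] : (ball (csub_val x) e `&` D) !=set0.
  apply: Dd; last exact: ball_open.
  by exists (csub_val x); exact: ballxx.
exists (p d); split; last by exists d.
apply: eO; rewrite -ball_normE /=.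
move: xd; rewrite -ball_normE /=; apply: le_lt_trans.
have -> : `|x - p d| = `|csub_val x - P d| by [].
rewrite -{1}(proj_id PP (set_mem (csub_in x))) -(linB (proj_linear PP)).
exact: proj_norm.
Qed.

End Extension.

(** * Star representations are bounded in the algebra variable *)

Section StarRep.
Context {R : realType} (A : cstarType R).
Implicit Types a b c : A.

Lemma cmulBl a a' b : cmul (a - a') b = cmul a b - cmul a' b.
Proof. exact: (linB (cmul_linearl b)). Qed.

Lemma cmulBr a b b' : cmul a (b - b') = cmul a b - cmul a b'.
Proof. exact: (linB (cmul_linearr a)). Qed.

Lemma cstar0 : cstar (0 : A) = 0.
Proof.
by have := cstar_antilinear (-1) (0 : A) 0; rewrite scaler0 add0r rmorphN1 scaleN1r addNr.
Qed.

Lemma cstarD a b : cstar (a + b) = cstar a + cstar b.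
Proof. by have := cstar_antilinear 1 a b; rewrite conjC1 !scale1r. Qed.

Lemma cstarZ k a : cstar (k *: a) = k^* *: cstar a.
Proof. by have := cstar_antilinear k a 0; rewrite cstar0 !addr0. Qed.

(** The C*-identity gives [|x|^2 <= |cstar x| * |x|]; this is applied to [a] and to [cstar a]. *)
Lemma norm_cstar a : `|cstar a| = `|a|.
Proof.
have le x : `|x| <= `|cstar x|.
  have [->|x0] := eqVneq x 0; first by rewrite normr0.
  have : `|x| ^+ 2 <= `|cstar x| * `|x| by rewrite -cnorm_star cnormM.
  by rewrite expr2 ler_pM2r// normr_gt0.
by apply/le_anti; rewrite -{2}(cstarK a) !le.
Qed.

Lemma invr2n_lt (e : R[i]) : 0 < e -> exists n, 2^-1 ^+ n < e.
Proof.
move=> e0; have r0 : 0 < complex.Re e := posRe e0.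
have [n ne] : exists n : nat, (complex.Re e)^-1 < n%:R.
  by exists (Num.truncn (complex.Re e)^-1).+1; rewrite truncnS_gt.
exists n; rewrite -(ReK (ltW e0)) exprVn.
have -> : (2 ^+ n)^-1 = ((2 ^+ n)^-1 : R)%:C%C by rewrite fmorphV rmorphXn rmorph_nat.
rewrite ltcR invf_plt ?posrE ?exprn_gt0//.
apply: lt_trans ne _; rewrite -natrX ltr_nat.
exact: ltn_expl.
Qed.

(* The iterates of [c |-> (b + c^2) / 2] stay in the ball of radius 1/2, on
   which this map is a contraction of ratio 1/2. *)
Lemma quasi_square_root b : cstar b = b -> `|b| <= 2^-1 ->
  exists2 c, cstar c = c & c + c = b + cmul c c.
Proof.
move=> bb b2.
pose f c := 2^-1 *: (b + cmul c c).
have h0 : (0 : R[i]) <= 2^-1 by rewrite invr_ge0.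
have fball c : `|c| <= 2^-1 -> `|f c| <= 2^-1.
  move=> c2; rewrite normrZ ger0_norm// -[leRHS]mulr1 ler_wpM2l//.
  rewrite (le_trans (ler_normD _ _))// (splitr 1) mul1r lerD//.
  apply: le_trans (cnormM _ _) _; apply: le_trans (ler_pM _ _ c2 c2) _ => //.
  by rewrite -[leRHS]mulr1 ler_wpM2l// invf_le1// ler1n.
have fdist c c' : `|c| <= 2^-1 -> `|c'| <= 2^-1 -> `|f c - f c'| <= 2^-1 * `|c - c'|.
  move=> c2 c'2; rewrite /f -scalerBr normrZ ger0_norm// ler_wpM2l//.
  have -> : b + cmul c c - (b + cmul c' c') = cmul c (c - c') + cmul (c - c') c'.
    by rewrite cmulBl cmulBr opprD addrACA subrr add0r addrA subrK.
  have -> : `|c - c'| = 2^-1 * `|c - c'| + 2^-1 * `|c - c'| by field.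
  rewrite (le_trans (ler_normD _ _))// lerD// (le_trans (cnormM _ _))//.
    exact: ler_wpM2r.
  by rewrite mulrC ler_wpM2r.
pose c n := iter n f 0.
have cb n : `|c n| <= 2^-1 by elim: n => [|n IH]; [rewrite normr0 | exact: fball].
have cd n k : `|c (n + k)%N - c n| <= 2^-1 ^+ n.
  elim: n => [|n IH]; first by rewrite subr0 (le_trans (cb _))// invf_le1// ler1n.
  by rewrite addSn /= exprS (le_trans (fdist _ _ (cb _) (cb _)))// ler_wpM2l.
have cc : cauchy (c @ \oo).
  apply: cauchy_exP => e e0; have [N Ne] := invr2n_lt e0.
  exists (c N), N => // n /= Nn.
  rewrite -ball_normE /= distrC -(subnKC Nn).
  exact: le_lt_trans (cd _ _) Ne.
have /cauchy_cvg/cvg_ex[/= l cl] := cc.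
have near_l e : 0 < e -> exists n, `|l - c n| < e /\ `|l - c n.+1| < e.
  move=> e0; have [N _ Nl] : (c @ \oo) (ball l e) by apply: cl; exact: nbhsx_ballx.
  exists N; split; first by have := Nl N (leqnn N); rewrite -ball_normE.
  by have := Nl N.+1 (leqnSn N); rewrite -ball_normE.
have cs n : cstar (c n) = c n.
  elim: n => [|n IH]; first exact: cstar0.
  by rewrite /= /f cstarZ cstarD cstarM bb IH conj_Creal// realV realn.
have lb : `|l| <= 2^-1.
  apply/ler_addgt0Pr => e e0; have [n [ln _]] := near_l e e0.
  rewrite -(subrK (c n) l) (le_trans (ler_normD _ _))// addrC.
  by apply: lerD => //; exact: ltW.
have lf : l = f l.
  apply/subr0_eq/normr0_eq0/le_anti; rewrite normr_ge0 andbT.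
  apply/ler_addgt0Pr => e e0; rewrite add0r.
  have [n [ln lSn]] := near_l (e / 2) ltac:(by rewrite divr_gt0).
  rewrite -{1}(subrK (c n.+1) l) -addrA [e]splitr (le_trans (ler_normD _ _))//.
  apply: lerD; first exact: ltW.
  apply: le_trans (fdist _ _ (cb n) lb) _.
  rewrite distrC; apply: le_trans (ltW ln).
  by rewrite -[leRHS]mul1r ler_wpM2r// invf_le1// ler1n.
exists l.
  apply/subr0_eq/normr0_eq0/le_anti; rewrite normr_ge0 andbT.
  apply/ler_addgt0Pr => e e0; rewrite add0r.
  have [n [ln _]] := near_l (e / 2) ltac:(by rewrite divr_gt0).
  have -> : cstar l - l = cstar (l - c n) - (l - c n).
    have -> : cstar l = cstar (l - c n) + c n by rewrite -{2}(cs n) -cstarD subrK.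
    by rewrite opprB addrA.
  rewrite (le_trans (ler_normB _ _))// norm_cstar [e]splitr.
  by apply: lerD; exact: ltW.
rewrite {1 2}lf /f -scalerDl (_ : 2^-1 + 2^-1 = 1) ?scale1r//.
by field.
Qed.

Context (H : hilbertType R) (pi : A -> H -> H) (pip : star_rep pi).

Lemma srep_lin a : linear_map (pi a). Proof. by case: pip => /(_ a)[]. Qed.
Lemma srep_cont a : continuous (pi a). Proof. by case: pip => /(_ a)[]. Qed.
Lemma srep_linl h : linear_map (fun a => pi a h).
Proof. by move=> k a b; case: pip. Qed.
Lemma srepM a b h : pi (cmul a b) h = pi a (pi b h). Proof. by case: pip. Qed.
Lemma srep_adj a x y : inner (pi a x) y = inner x (pi (cstar a) y).
Proof. by case: pip => _ _ _; apply. Qed.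
Lemma srep_adjr a x y : inner x (pi a y) = inner (pi (cstar a) x) y.
Proof. by rewrite srep_adj cstarK. Qed.

(* [I - pi b = (I - pi c)^2] when [c + c = b + c^2]; positivity of the right
   hand side bounds [pi b] without assuming continuity of [pi]. *)
Lemma srep_selfadj_le b h : cstar b = b -> `|b| <= 2^-1 ->
  inner h (pi b h) <= `|h| ^+ 2.
Proof.
move=> bb b2; have [c cs cE] := quasi_square_root bb b2.
have -> : inner h (pi b h) = `|h| ^+ 2 - `|h - pi c h| ^+ 2.
  have -> : b = c + c - cmul c c by rewrite cE addrK.
  rewrite (linB (srep_linl h)) (linD (srep_linl h)) srepM.
  rewrite -!inner_norm innerBl !innerBr innerDr srep_adj cs.
  by rewrite srep_adj cs; ring.
by rewrite lerBlDr lerDl exprn_ge0.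
Qed.

(** [star_rep] only makes each [pi a] bounded; continuity in [a] is derived here. The factor 2 is
    not sharp, but suffices for continuity. *)
Lemma srep_bound a h : `|pi a h| <= 2 * `|a| * `|h|.
Proof.
have [->|a0] := eqVneq a 0.
  by rewrite (lin0 (srep_linl h)) !normr0 mulr0 mul0r.
have n0 : 0 < `|a| by rewrite normr_gt0.
(* After rescaling [a] to norm 1/2, [cmul (cstar a') a'] has norm 1/4, within reach of
   [srep_selfadj_le]. *)
pose k := (2 * `|a|)^-1; have k0 : 0 < k by rewrite invr_gt0 mulr_gt0.
pose a' := k *: a.
have na' : `|a'| = 2^-1.
  rewrite normrZ gtr0_norm// /k invfM -mulrA mulVf ?mulr1// gt_eqF//.
suff le1 : `|pi a' h| <= `|h|.
  move: le1; rewrite (linZ (srep_linl h)) normrZ gtr0_norm//.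
  by rewrite ler_pdivrMl// mulr_gt0.
rewrite -(@ler_pXn2r _ 2) ?nnegrE// -inner_norm srep_adj -srepM.
apply: srep_selfadj_le; first by rewrite cstarM cstarK.
rewrite cnorm_star na' expr2 -[leRHS]mulr1 ler_pM2l ?invr_gt0//.
by rewrite invf_le1// ler1n.
Qed.

End StarRep.

(** * Closed linear subspaces and ranges of isometries *)

Section ClosedLinear.
Context {R : realType}.

Definition closed_linear (V : normedModType R[i]) (P : set V) : Prop :=
  [/\ closed P, P 0 & forall c x y, P x -> P y -> P (c *: x + y)].

Lemma total_closed_linear (V : normedModType R[i]) (S P : set V) :
  total_set S -> closed_linear P -> S `<=` P -> forall x, P x.
Proof. by move=> St [Pc P0 Pl]; exact: total_ind. Qed.

Lemma closed_linear_preimage (V W : normedModType R[i]) (f : V -> W) (P : set W) :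
  linear_map f -> continuous f -> closed_linear P -> closed_linear (f @^-1` P).
Proof.
move=> fl fc [Pc P0 Pl]; split; first exact: closed_preimage_cont.
  by rewrite /= (lin0 fl).
by move=> c x y /= fx fy; rewrite fl; exact: Pl.
Qed.

Lemma closed_linear_eq (V W : normedModType R[i]) (f g : V -> W) :
  linear_map f -> continuous f -> linear_map g -> continuous g ->
  closed_linear [set x | f x = g x].
Proof.
move=> fl fc gl gc.
have -> : [set x | f x = g x] = [set x | f x - g x = 0].
  by apply/seteqP; split=> x /=; [move=> ->; rewrite subrr | exact: subr0_eq].
split=> /=.
- by apply: (closed_eq0 (f := fun x => f x - g x)) => x; exact: continuousB (fc x) (gc x).
- by rewrite (lin0 fl) (lin0 gl) subrr.
- move=> c x y fgx fgy.
  by rewrite fl gl opprD addrACA -scalerBr fgx fgy scaler0 addr0.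
Qed.

Lemma cset_closed_linear (H : hilbertType R) (K : csubspace H) :
  closed_linear (cset K).
Proof. by split; [exact: cset_closed | exact: cset0 | exact: csetP]. Qed.

Definition closed_linear_csub (H : hilbertType R) (P : set H)
  (Pcl : closed_linear P) : csubspace H :=
  let: And3 Pc P0 Pl := Pcl in CSubspace P0 Pl Pc.

Lemma closed_linear_csubE (H : hilbertType R) (P : set H) (Pcl : closed_linear P) :
  cset (closed_linear_csub Pcl) = P.
Proof. by case: Pcl. Qed.

Lemma closed_linear_orthr (H : hilbertType R) (y : H) :
  closed_linear [set x | inner x y = 0].
Proof.
split; [exact: closed_orthl | by rewrite /= inner0l |].
by move=> c x z /= xy zy; rewrite innerDl innerZl xy zy mulr0 addr0.
Qed.

Lemma isometry_cont (V W : normedModType R[i]) (f : V -> W) :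
  linear_map f -> (forall x, `|f x| = `|x|) -> continuous f.
Proof.
by move=> fl fn; apply: (bounded_linear_cont (M := 1)) => // x; rewrite fn mul1r.
Qed.

Lemma inner_isometry_norm (V W : hilbertType R) (u : V -> W) :
  (forall a b, inner (u a) (u b) = inner a b) -> forall x, `|u x| = `|x|.
Proof.
move=> uu x; have : `|u x| ^+ 2 = `|x| ^+ 2 by rewrite -!inner_norm uu.
by move/eqP; rewrite eqrXn2// => /eqP.
Qed.

(** Preimages of approximations of [w] form a Cauchy filter because [u] preserves distances; [u]
    sends its limit to [w]. *)
Lemma isometry_range_closed (V W : hilbertType R) (u : V -> W) :
  linear_map u -> (forall x, `|u x| = `|x|) -> closed_linear (range u).
Proof.
move=> ul un; split; last first.
- by move=> c _ _ [x _ <-] [y _ <-]; exists (c *: x + y).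
- by exists 0 => //; exact: lin0.
apply: closed_dist => w wu.
pose B e := [set v | `|w - u v| < e].
pose F := filter_from [set e : R[i] | 0 < e] B.
have FF : ProperFilter F.
  apply: filter_from_proper; last by move=> e /= /wu[_ [v _ <-] wv]; exists v.
  apply: filter_from_filter; first by exists 1; exact: ltr01.
  move=> e e' /= e0 e'0.
  have /orP[h|h] : (e <= e') || (e' <= e) by apply: real_leVge; exact: gtr0_real.
    by exists e => // v wv; split=> //; exact: lt_le_trans h.
  by exists e' => // v wv; split=> //; exact: lt_le_trans h.
have Bdist e v v' : B e v -> B e v' -> `|v - v'| < e + e.
  move=> wv wv'; rewrite -un (linB ul).
  have -> : u v - u v' = (w - u v') - (w - u v) by rewrite opprB [RHS]addrC addrA subrK.
  by rewrite (le_lt_trans (ler_normB _ _))// ltrD.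
have Fc : cauchy F.
  apply: cauchy_exP => e e0.
  have e20 : 0 < e / 2 by rewrite divr_gt0.
  have [_ [v _ <-] wv] := wu _ e20; exists v; exists (e / 2) => // v' wv'.
  by rewrite -ball_normE /= [e]splitr; apply: Bdist.
have /cvg_ex[/= v Fv] := @cauchy_cvg _ F FF Fc.
exists v => //; apply/subr0_eq/normr0_eq0/le_anti; rewrite normr_ge0 andbT.
apply/ler_addgt0Pr => e e0; rewrite add0r.
have e20 : 0 < e / 2 by rewrite divr_gt0.
have FB : F (ball v (e / 2)) by apply: Fv; exact: nbhsx_ballx.
have FBe : F (B (e / 2)) by exists (e / 2).
have [v' [vv' wv']] := filter_ex (filterI FB FBe).
rewrite -(subrK (u v') (u v)) -addrA [e]splitr (le_trans (ler_normD _ _))//.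
apply: lerD; last by rewrite distrC ltW.
by rewrite -(linB ul) un; move: vv'; rewrite -ball_normE => /ltW.
Qed.

End ClosedLinear.

(** * Restriction of operators to invariant subspaces *)

Section Restriction.
Context {R : realType} (H : hilbertType R) (K : csubspace H).

Lemma restrE (f : H -> H) (x : csub K) :
  (forall h, cset K h -> cset K (f h)) ->
  csub_val (restr f x) = f (csub_val x).
Proof.
move=> fK; rewrite /restr -[csub_val (insubd _ _)]/(val (insubd _ _)).
by rewrite insubdK//; apply/mem_set/fK/set_mem/csub_in.
Qed.

Lemma csub_inj (x y : csub K) : csub_val x = csub_val y -> x = y.
Proof. exact: val_inj. Qed.

Lemma restr_bounded (f : H -> H) :
  (forall h, cset K h -> cset K (f h)) ->
  bounded_operator f -> bounded_operator (restr (K := K) f).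
Proof.
move=> fK [fl fc]; split.
  move=> c x y; apply: csub_inj; rewrite restrE//.
  rewrite -[csub_val (_ *: _ + _)]/(c *: csub_val x + csub_val y) fl.
  by rewrite -[RHS]/(c *: csub_val (restr f x) + csub_val (restr f y)) !restrE.
move=> x B /nbhs_ballP[e /= e0 eB].
have /cvgrPdist_lt/(_ e e0)/nbhs_ballP[d /= d0 dP] := fc (csub_val x).
apply/nbhs_ballP; exists d => // y; rewrite -ball_normE /= => xy.
apply: eB; rewrite -ball_normE /=.
rewrite -[`|restr f x - _|]/`|csub_val (restr f x) - csub_val (restr f y)|.
by rewrite !restrE//; apply: dP; rewrite -ball_normE.
Qed.

End Restriction.

(** * Induction over the Fock module *)

Section FockInduction.
Context {R : realType} {A : cstarType R} (E : corrType A) (F : fock_module E).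

Lemma fock_inj_cont m : continuous (@fock_inj R A E F m).
Proof.
apply: isometry_cont; first exact: fock_inj_linear.
move=> x; have : `|fock_inj x : F| ^+ 2 = `|x| ^+ 2.
  by rewrite !cinner_norm fock_inj_form.
by move/eqP; rewrite eqrXn2// => /eqP.
Qed.

(** [P] may vary with the degree, as the spaces [D_(m+1)^perp] do. Totality of elementary tensors
    carries it from one degree to the next. *)
Lemma fock_graded_ind (P : nat -> set F) :
  (forall m, closed_linear (P m)) ->
  (forall a : regular A, P 0%N (@fock_inj _ _ _ F 0 a)) ->
  (forall m xi x, P m (@fock_inj _ _ _ F m x) ->
    P m.+1 (@fock_inj _ _ _ F m.+1 (fock_tens xi x))) ->
  forall m x, P m (@fock_inj _ _ _ F m x).
Proof.
move=> Pcl P0 PS; elim=> [|m IH]; first exact: P0.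
have [_ _ _ _ tot] := @fock_tensP _ _ _ F m.
move=> x.
apply: (total_closed_linear (P := @fock_inj _ _ _ F m.+1 @^-1` P m.+1) tot).
  apply: closed_linear_preimage => //; first exact: fock_inj_linear.
  exact: fock_inj_cont.
by move=> _ [xi _ [y _ <-]]; apply: PS; exact: IH.
Qed.

Lemma fock_inj_ind (P : set F) : closed_linear P ->
  (forall m x, P (@fock_inj _ _ _ F m x)) -> forall f, P f.
Proof.
move=> Pcl Pinj; apply: (total_closed_linear (@fock_total _ _ _ F) Pcl).
by move=> _ [m [x ->]].
Qed.

Lemma fock_ind (P : set F) : closed_linear P ->
  (forall a : regular A, P (@fock_inj _ _ _ F 0 a)) ->
  (forall xi f, P f -> P (fock_create xi f)) ->
  forall f, P f.
Proof.
move=> Pcl P0 PS; apply: fock_inj_ind => //.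
apply: (fock_graded_ind (P := fun=> P)) => // m xi x Px.
by rewrite -fock_create_inj; exact: PS.
Qed.

End FockInduction.

(** * Induced subspaces described by vectors of the ambient space *)

Section Frames.
Context {R : realType} {A : cstarType R} (E : corrType A) (H : hilbertType R).
Context (sigma : A -> H -> H) (T : E -> H -> H).
Implicit Types (M N : csubspace H).

(** [tau f k] stands for the image in [M] of the elementary tensor of [f] and [k]. The model space
    and the unitary of [induced] are thus absorbed, and all arguments take place in [H]. *)
Record frame (M : csubspace H) (F : fock_module E) (K : hilbertType R)
    (pi : A -> K -> K) (tau : F -> K -> H) : Prop := Frame {
  frame_separable : separable K;
  frame_rep : nondegenerate_rep pi;
  frame_linl : forall k, linear_map (fun f => tau f k);
  frame_linr : forall f, linear_map (tau f);
  frame_inner : forall f k g l,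
    inner (tau f k) (tau g l) = inner k (pi (cinner f g) l);
  frame_in : forall f k, cset M (tau f k);
  frame_total : forall z, cset M z ->
    (forall f k, inner (tau f k) z = 0) -> z = 0;
  frame_sigma : forall a f k, sigma a (tau f k) = tau (lact a f) k;
  frame_T : forall xi f k, T xi (tau f k) = tau (fock_create xi f) k
}.

Definition invariant M := (forall a h, cset M h -> cset M (sigma a h)) /\
  (forall xi h, cset M h -> cset M (T xi h)).

Definition framed M := exists F K pi tau, @frame M F K pi tau.

Lemma framed_of_induced M : invariant M -> restr_induced sigma T M -> framed M.
Proof.
move=> [Msig MT] [F [K [pi [X [t [rho [S [U]]]]]]]].
move=> [[Ks pind] [tX rhob Sb rhot St] [Ul Uu Us] Urho US].
have [[tl tr] ti tt] := tX.
pose tau f k := csub_val (U (t f k)).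
exists F, K, pi, tau; split=> //.
- move=> k c f g; rewrite /tau.
  by rewrite (_ : t (c *: f + g) k = c *: t f k + t g k)// Ul.
- by move=> f c k l; rewrite /tau (_ : t f (c *: k + l) = c *: t f k + t f l)// Ul.
- by move=> f k g l; rewrite -ti -Uu.
- by move=> f k; exact: set_mem (csub_in _).
- move=> z Mz tz; have [x Ux] := Us (CSub (mem_set Mz)).
  suff x0 : x = 0 by rewrite x0 (lin0 Ul) in Ux; have := congr1 (@csub_val _ _ _) Ux.
  apply: (total_orth tt) => _ [f _ [k _ <-]].
  by rewrite -Uu Ux; exact: tz.
- by move=> a f k; rewrite /tau -rhot Urho restrE//; exact: Msig.
- by move=> xi f k; rewrite /tau -St US restrE//; exact: MT.
Qed.

Lemma induced_of_framed M : (forall a, bounded_operator (sigma a)) ->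
  (forall xi, bounded_operator (T xi)) -> invariant M -> framed M ->
  restr_induced sigma T M.
Proof.
move=> sigb Tb [Msig MT] [F [K [pi [tau [Ks pind tl tr ti tin ttot tsig tT]]]]].
pose t f k : csub M := CSub (mem_set (tin f k)).
(* [csub M] itself serves as the tensor product, with the identity as unitary. *)
exists F, K, pi, (csub M), t, (fun a => restr (sigma a)), (fun xi => restr (T xi)), id.
split=> //.
- split.
  + split.
    * by split=> *; apply: csub_inj; [exact: tl | exact: tr].
    * exact: ti.
    * apply: total_of_orth => x xt; apply: csub_inj.
      apply: ttot => [|f k]; first exact: set_mem (csub_in _).
      by apply: (xt (t f k)); exists f => //; exists k.
  + by move=> a; apply: restr_bounded => //; exact: Msig.
  + by move=> xi; apply: restr_bounded => //; exact: MT.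
  + by move=> a f k; apply: csub_inj; rewrite restrE; [exact: tsig | exact: Msig].
  + by move=> xi f k; apply: csub_inj; rewrite restrE; [exact: tT | exact: MT].
- by split=> // y; exists y.
Qed.

Section FrameTheory.
Context M (F : fock_module E) (K : hilbertType R) (pi : A -> K -> K).
Context (tau : F -> K -> H) (fr : frame M pi tau).

Let pis : star_rep pi. Proof. by case: (frame_rep fr). Qed.

Lemma frame_bound f k : `|tau f k| <= 2 * `|f| * `|k|.
Proof.
rewrite -(@ler_pXn2r _ 2) ?nnegrE ?mulr_ge0//.
rewrite -inner_norm (frame_inner fr) -[X in X <= _]ger0_norm; last first.
  by rewrite -(frame_inner fr) inner_norm exprn_ge0.
apply: le_trans (Cauchy_Schwarz _ _) _.
apply: le_trans (ler_wpM2l _ (srep_bound pis _ _)) _ => //.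
rewrite -cinner_norm.
(* The square of the claimed bound is twice the estimate reached so far. *)
have -> : (2 * `|f| * `|k|) ^+ 2 =
  `|k| * (2 * `|f| ^+ 2 * `|k|) + `|k| * (2 * `|f| ^+ 2 * `|k|) by ring.
by rewrite lerDl !mulr_ge0.
Qed.

Lemma frame_contl k : continuous (fun f => tau f k).
Proof.
apply: (bounded_linear_cont (M := 2 * `|k|)); first exact: frame_linl fr k.
by move=> f; rewrite mulrAC; exact: frame_bound.
Qed.

Lemma frame_contr f : continuous (tau f).
Proof.
apply: (bounded_linear_cont (M := 2 * `|f|)); first exact: frame_linr fr f.
by move=> k; exact: frame_bound.
Qed.

Lemma frame_preimage k (P : set H) :
  closed_linear P -> closed_linear [set f | P (tau f k)].
Proof.
exact: (closed_linear_preimage (frame_linl fr k) (@frame_contl k)).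
Qed.

(** Both sides have the same inner product with every [tau g l], so their difference is orthogonal
    to itself. *)
Lemma frame_balanced f a k : tau (ract f a) k = tau f (pi a k).
Proof.
apply/subr0_eq/inner_self_eq0.
have o g l : inner (tau g l) (tau (ract f a) k - tau f (pi a k)) = 0.
  by rewrite innerBr !(frame_inner fr) cinner_ract srepM// subrr.
by rewrite innerBl !o subrr.
Qed.

Lemma frame_orth z : cset M z ->
  (forall m x k, inner (tau (@fock_inj _ _ _ F m x) k) z = 0) -> z = 0.
Proof.
move=> Mz z0; apply: (frame_total fr) => // f k.
apply: (fock_inj_ind (P := [set f | inner (tau f k) z = 0])) => //.
  exact: (frame_preimage k (closed_linear_orthr z)).
by move=> m x; exact: z0.
Qed.

End FrameTheory.

End Frames.

(** * Isometric representations and their wandering vectors *)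

Section Isometric.
Context {R : realType} {A : cstarType R} (E : corrType A) (H : hilbertType R).
Context (sigma : A -> H -> H) (T : E -> H -> H) (Tiso : isometric_rep sigma T).
Implicit Types (M N : csubspace H).

Lemma iso_star_rep : star_rep sigma. Proof. by case: Tiso => [[[]]]. Qed.
Let sigs := iso_star_rep.

Lemma iso_bounded xi : bounded_operator (T xi).
Proof. by case: Tiso => [[_ [Tb _] _ _] _]. Qed.

Lemma iso_lin xi : linear_map (T xi). Proof. by case: (iso_bounded xi). Qed.
Lemma iso_cont xi : continuous (T xi). Proof. by case: (iso_bounded xi). Qed.

Lemma iso_inner xi h eta k :
  inner (T xi h) (T eta k) = inner h (sigma (cinner xi eta) k).
Proof. by case: Tiso => _ /(_ xi eta)[T' adj <-]; exact: adj. Qed.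

Lemma iso_adjoint : exists T' : E -> H -> H, forall xi, adjoint_pair (T xi) (T' xi).
Proof.
suff /choice[T' T'P] : forall xi, exists T', adjoint_pair (T xi) T' by exists T'.
by move=> xi; case: Tiso => _ /(_ xi xi)[T' adj _]; exists T'.
Qed.

Lemma iso_ract xi a h : T (ract xi a) h = T xi (sigma a h).
Proof.
apply/subr0_eq/inner_self_eq0.
have o eta k : inner (T eta k) (T (ract xi a) h - T xi (sigma a h)) = 0.
  by rewrite innerBr !iso_inner cinner_ract (srepM sigs) subrr.
by rewrite innerBl !o subrr.
Qed.

(** Covariance treats both actions at once. As [A] may lack a unit, the right factor is removed by
    testing on the total set of vectors [sigma b k]. *)
Lemma iso_lact a xi h : T (lact a xi) h = sigma a (T xi h).
Proof.
have [[_ sn] _ _ Tcov] := Tiso.1.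
apply: (total_closed_linear (P := [set h | T (lact a xi) h = sigma a (T xi h)]) sn).
  apply: closed_linear_eq.
  - exact: iso_lin.
  - exact: iso_cont.
  - by move=> c x y; rewrite iso_lin (srep_lin sigs).
  - move=> x; apply: (continuous_comp (f := T xi) (g := sigma a)).
      exact: iso_cont.
    exact: (srep_cont sigs).
by move=> _ [b _ [k _ <-]] /=; rewrite -iso_ract Tcov.
Qed.

(** The sets [D_m]. They matter through their orthogonal complements, which spans and closures do
    not change, so neither is taken. *)
Fixpoint range_power (m : nat) : set H :=
  if m is m'.+1 then [set T xi d | xi in setT & d in range_power m'] else setT.

Lemma range_power_sigma m a d : range_power m d -> range_power m (sigma a d).
Proof.
case: m => //= m [xi _ [e me <-]].
by exists (lact a xi) => //; exists e => //; rewrite iso_lact.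
Qed.

(** The inner product with [T xi d] becomes one of [y] with [sigma] applied to [d], and [D_m] is
    stable under [sigma]. *)
Lemma range_power_orth m eta y : orthocomp (range_power m) y ->
  orthocomp (range_power m.+1) (T eta y).
Proof.
move=> oy _ [xi _ [d md <-]]; rewrite iso_inner (srep_adjr sigs).
exact/oy/range_power_sigma.
Qed.

(** [reduces] only provides some projection commuting with [sigma]; uniqueness of projections
    transfers this to the given [P]. *)
Lemma reduces_proj M P : reduces sigma T M -> orth_projection M P ->
  (forall a h, P (sigma a h) = sigma a (P h)) /\
  (forall xi h, P (T xi h) = T xi (P h)).
Proof.
move=> [[P' PP' P'sig] MT MT'] PP; split.
  move=> a h; have PE k : P k = P' k by apply: (proj_uniq PP); case: (PP' k).
  by rewrite !PE.
by move=> xi; apply: (proj_commute PP) => //; [exact: iso_lin | exact: MT | exact: MT'].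
Qed.

Lemma reduces_invariant M : reduces sigma T M -> invariant sigma T M.
Proof.
move=> rM; have [P PP] := orth_projection_exists M.
have [Ps _] := reduces_proj rM PP; case: rM => _ MT _; split=> // a h Mh.
by rewrite -(proj_id PP Mh) -Ps; exact: proj_in PP _.
Qed.

Section Sub.
Context N (F : fock_module E) (K : hilbertType R) (pi : A -> K -> K).
Context (tau : F -> K -> H) (fr : frame sigma T N pi tau) (rN : reduces sigma T N).

Let pis : star_rep pi. Proof. by case: (frame_rep fr). Qed.

(** Induction on the degree, with [range_power_orth] as the step. [D_(m+1)] is formed in all of [H],
    so the base case needs that [N] reduces [T]. *)
Lemma frame_wandering m x k :
  orthocomp (range_power m.+1) (tau (@fock_inj _ _ _ F m x) k).
Proof.
apply: (fock_graded_ind (P := fun m => [set f | orthocomp (range_power m.+1) (tau f k)])).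
- move=> p; apply: (frame_preimage fr).
  exact: cset_closed_linear (orthoc (range_power p.+1)).
- move=> a /= _ [xi _ [h _ <-]]; set y := tau _ k.
  have Ny : cset N y by exact: frame_in fr _ _.
  have [T' T'P] := iso_adjoint; have [P PP] := orth_projection_exists N.
  have [_ PT] := reduces_proj rN PP.
  (* [T xi] maps each homogeneous frame vector to positive degree, whereas [y] has degree 0. *)
  have z0 : P (T' xi y) = 0.
    apply: (frame_orth fr); first exact: proj_in PP _.
    move=> p x' k'; rewrite -(proj_sym PP) (proj_id PP); last exact: frame_in fr _ _.
    rewrite -T'P (frame_T fr) fock_create_inj (frame_inner fr) fock_inj_orth//.
    by rewrite (lin0 (srep_linl pis k)) inner0r.
  by rewrite -(proj_id PP Ny) -(proj_sym PP) PT T'P (proj_sym PP) z0 inner0r.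
- move=> p xi x' IH; have := range_power_orth xi IH.
  by rewrite (frame_T fr) fock_create_inj.
Qed.

(** Without a unit, [u k] cannot be the tensor of 1 and [k]. Instead [pi a k] is sent to the tensor
    of [a] and [k]: the Gram matrices agree, and nondegeneracy makes the vectors [pi a k] total. *)
Lemma frame_wandering_isometry : exists u : K -> H,
  [/\ linear_map u, forall k l, inner (u k) (u l) = inner k l,
    forall k, cset N (u k) /\ orthocomp (range_power 1) (u k),
    forall a k, sigma a (u k) = tau (@fock_inj _ _ _ F 0 a) k
    & forall a k, u (pi a k) = sigma a (u k)].
Proof.
pose s (p : A * K) := pi p.1 p.2.
pose y (p : A * K) := tau (@fock_inj _ _ _ F 0 p.1) p.2.
have s_total : total_set (range s).
  case: (frame_rep fr) => _; rewrite /nondegenerate_action.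
  rewrite (_ : [set pi a x | a in setT & x in setT] = range s)//.
  apply/seteqP; split; first by move=> _ [a _ [k _ <-]]; exists (a, k).
  by move=> _ [[a k] _ <-]; exists a => //; exists k.
have [|u [ul uu us]] := @isometric_extension R K H _ s y s_total.
  move=> [a k] [b l]; rewrite /s /y /= (srep_adj pis) -(srepM pis).
  by rewrite (frame_inner fr) fock_inj_form.
have un := inner_isometry_norm uu.
have uc := isometry_cont ul un.
have upi a k : u (pi a k) = tau (@fock_inj _ _ _ F 0 a) k := us (a, k).
have usig a k : sigma a (u k) = tau (@fock_inj _ _ _ F 0 a) k.
  apply: (total_closed_linear
    (P := [set k | sigma a (u k) = tau (@fock_inj _ _ _ F 0 a) k]) s_total).
    apply: closed_linear_eq.
    - by move=> c v w; rewrite ul (srep_lin sigs).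
    - move=> v; apply: (continuous_comp (f := u) (g := sigma a)); first exact: uc.
      exact: (srep_cont sigs).
    - exact: frame_linr fr _.
    - exact: (frame_contr fr).
  move=> _ [[b l] _ <-]; rewrite /s /= upi (frame_sigma fr) -fock_inj_lact.
  by rewrite -(frame_balanced fr) -fock_inj_ract.
exists u; split=> //; last by move=> a k; rewrite upi usig.
move=> k.
have [in1 in2] : (cset N `&` orthocomp (range_power 1)) (u k); last by [].
apply: (total_closed_linear
  (P := u @^-1` (cset N `&` orthocomp (range_power 1))) s_total).
  apply: closed_linear_preimage => //.
  have [c1 z1 l1] := cset_closed_linear N.
  have [c2 z2 l2] := cset_closed_linear (orthoc (range_power 1)).
  split; [exact: closedI | by [] |].
  by move=> c v w [? ?] [? ?]; split; [exact: l1 | exact: l2].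
move=> _ [[a l] _ <-]; split; last by have := @frame_wandering 0 a l; rewrite -upi.
by rewrite /s /= upi; exact: frame_in fr _ _.
Qed.

(** [u k] is the projection of [w] onto the closed range of [u]. The difference is orthogonal to
    degree 0 by this choice, and to higher degrees because [w] and [u k] both lie in [D_1^perp]. *)
Lemma wandering_in_range (u : K -> H) w : linear_map u ->
  (forall k l, inner (u k) (u l) = inner k l) ->
  (forall k, cset N (u k) /\ orthocomp (range_power 1) (u k)) ->
  (forall a k, sigma a (u k) = tau (@fock_inj _ _ _ F 0 a) k) ->
  (forall a k, u (pi a k) = sigma a (u k)) ->
  cset N w -> orthocomp (range_power 1) w -> exists k, u k = w.
Proof.
move=> ul uu uN usig upi Nw ow.
have rcl := isometry_range_closed ul (inner_isometry_norm uu).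
have [p [rp wp]] := projection_point (closed_linear_csub rcl) w.
move: rp wp; rewrite closed_linear_csubE => -[k _ <-] wk; exists k.
have [Nk ok] := uN k.
apply/esym/subr0_eq/(frame_total fr) => [|f l]; first exact: csetB.
apply: (fock_ind (P := [set f | inner (tau f l) (w - u k) = 0])).
- exact: (frame_preimage fr l (closed_linear_orthr _)).
- by move=> a /=; rewrite -usig -upi; apply: wk; exists (pi a l).
- move=> xi g _ /=; rewrite -(frame_T fr).
  have rp : range_power 1 (T xi (tau g l)) by exists xi => //; exists (tau g l).
  by rewrite innerBr ow// ok// subrr.
Qed.

End Sub.

End Isometric.

(** * Passage to reducing subspaces, and orthogonality of the two types *)

Section Reducing.
Context {R : realType} {A : cstarType R} (E : corrType A) (H : hilbertType R).
Context (sigma : A -> H -> H) (T : E -> H -> H) (Tiso : isometric_rep sigma T).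
Implicit Types (M N : csubspace H).

Let sigs := iso_star_rep Tiso.

Lemma framed_sub M N : cset M `<=` cset N ->
  reduces sigma T N -> reduces sigma T M -> framed sigma T N -> framed sigma T M.
Proof.
move=> MN rN rM [F [K [pi [tau fr]]]].
have [pis pin] := frame_rep fr.
have [u [ul uu uN usig upi]] := frame_wandering_isometry Tiso fr rN.
have uc := isometry_cont ul (inner_isometry_norm uu).
have [P PP] := orth_projection_exists M.
have [Psig PT] := reduces_proj Tiso rM PP.
have [Msig MT] := reduces_invariant Tiso rM.
have Pl := proj_linear PP.
have Pc : continuous P.
  by apply: (bounded_linear_cont (M := 1)) => // h; rewrite mul1r; exact: proj_norm.
pose K' := closed_linear_csub (closed_linear_preimage ul uc (cset_closed_linear M)).
have K'E k : cset K' k <-> cset M (u k).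
  by rewrite /K' closed_linear_csubE.
(* [P] preserves orthogonality to [D_1], so [P (u k)] is again some [u k']. As [P] commutes with
   [sigma] and [T], this [k'] describes [P] on all [tau f k]. *)
have split k : exists2 k', cset K' k' &
    u k' = P (u k) /\ forall f, tau f k' = P (tau f k).
  have [Nk ok] := uN k.
  have [k' uk'] : exists k', u k' = P (u k).
    apply: (wandering_in_range fr ul uu uN usig upi).
      by apply: MN; exact: proj_in PP _.
    move=> _ [xi _ [d _ <-]]; rewrite -(proj_sym PP) PT.
    by apply: ok; exists xi => //; exists (P d).
  exists k'; first by apply/K'E; rewrite uk'; exact: proj_in PP _.
  split=> // f.
  apply: (fock_ind (P := [set f | tau f k' = P (tau f k)])).
  - apply: closed_linear_eq.
    + exact: frame_linl fr k'.
    + exact: (frame_contl fr (k := k')).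
    + by move=> c g g'; rewrite (frame_linl fr) Pl.
    + move=> g; apply: (continuous_comp (f := fun f => tau f k) (g := P)).
        exact: (frame_contl fr (k := k)).
      exact: Pc.
  - by move=> a /=; rewrite -!usig uk' Psig.
  - by move=> xi g /= IH; rewrite -!(frame_T fr) IH PT.
have K'pi a k : cset K' k -> cset K' (pi a k).
  by move=> /K'E Mk; apply/K'E; rewrite upi; exact: Msig.
pose pi' a := restr (K := K') (pi a).
have pi'E a x : csub_val (pi' a x) = pi a (csub_val x) by apply: restrE; exact: K'pi.
exists F, (csub K'), pi', (fun f k => tau f (csub_val k)); split.
- exact: separable_csub (frame_separable fr).
- split.
    split.
    + by move=> a; apply: restr_bounded; [exact: K'pi | case: pis].
    + move=> c a b h; apply: csub_inj; rewrite pi'E (srep_linl pis).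
      by rewrite -!pi'E.
    + by move=> a b h; apply: csub_inj; rewrite !pi'E (srepM pis).
    + move=> a x y.
      rewrite -[LHS]/(inner (csub_val (pi' a x)) (csub_val y)).
      rewrite -[RHS]/(inner (csub_val x) (csub_val (pi' (cstar a) y))) !pi'E.
      exact: (srep_adj pis).
  apply: total_of_orth => x x0; apply: csub_inj; apply: (total_orth pin).
  move=> _ [a _ [k _ <-]].
  have Mx : cset M (u (csub_val x)) by apply/K'E/set_mem/csub_in.
  (* Since [u] maps [x] into [M], pairing [x] with [pi a k] is the same as pairing it with
     [pi a k'], where [k'] lies in [K']. *)
  have [k' Kk' [uk' _]] := split k.
  rewrite -uu upi -(proj_id PP Mx) -(proj_sym PP) Psig -uk' -upi uu.
  pose k1 : csub K' := CSub (mem_set Kk').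
  have := x0 (pi' a k1).
  rewrite -[inner (pi' _ _) x]/(inner (csub_val (pi' a k1)) (csub_val x)) pi'E.
  by apply; exists a => //; exists k1.
- by move=> k; exact: frame_linl fr _.
- by move=> f c x y; exact: frame_linr fr f c (csub_val x) (csub_val y).
- move=> f k g l; rewrite (frame_inner fr).
  by rewrite -[RHS]/(inner (csub_val k) (csub_val (pi' (cinner f g) l))) pi'E.
- move=> f k; have Mk : cset M (u (csub_val k)) by apply/K'E/set_mem/csub_in.
  apply: (fock_ind (P := [set f | cset M (tau f (csub_val k))])).
  + exact: (frame_preimage fr _ (cset_closed_linear M)).
  + by move=> a /=; rewrite -usig; exact: Msig.
  + by move=> xi g /=; rewrite -(frame_T fr); exact: MT.
- move=> z Mz z0; apply: (frame_total fr); first exact: MN.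
  move=> f k; have [k' Kk' [_ tk']] := split k.
  rewrite -(proj_id PP Mz) -(proj_sym PP) -tk'.
  exact: z0 f (CSub (mem_set Kk')).
- by move=> a f k; exact: frame_sigma fr _ _ _.
- by move=> xi f k; exact: frame_T fr _ _ _.
Qed.

(** Density in [N] of the span of the [T xi h], stated by orthogonality. For reducing [N] it is
    equivalent to full coisometry, by the next two lemmas. *)
Definition range_dense N :=
  forall x, cset N x -> (forall xi h, cset N h -> inner (T xi h) x = 0) -> x = 0.

(** A vector orthogonal to all [T xi h] is killed by the adjoint [Tt'], and [Tt (Tt' x) = x]. *)
Lemma range_dense_of_coisometric N : reduces sigma T N ->
  restr_fully_coisometric sigma T N -> range_dense N.
Proof.
move=> rN [Y [t [Tt [Tt' [[_ _ tt] [Ttl _] Ttt adj Tc]]]]] x Nx x0.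
have [_ NT] := reduces_invariant Tiso rN.
pose x' : csub N := CSub (mem_set Nx).
suff y0 : Tt' x' = 0.
  by have := congr1 (@csub_val _ _ _) (Tc x'); rewrite y0 (lin0 Ttl).
apply: (total_orth tt) => _ [xi _ [h _ <-]].
rewrite -adj Ttt.
rewrite -[inner _ x']/(inner (csub_val (restr (T xi) h)) x) restrE; last exact: NT.
by apply: x0; exact/set_mem/csub_in.
Qed.

(* For an isometric representation the space itself, with the elementary
   tensors [T xi h], is a model of the tensor product of [E] and [N]. *)
Lemma coisometric_of_range_dense N : reduces sigma T N ->
  range_dense N -> restr_fully_coisometric sigma T N.
Proof.
move=> rN dN; have [Nsig NT] := reduces_invariant Tiso rN.
have TE xi (h : csub N) : csub_val (restr (T xi) h) = T xi (csub_val h).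
  by apply: restrE; exact: NT.
exists (csub N), (fun xi => restr (T xi)), id, id; split=> //.
split.
- split=> [h k x x'|x k h h']; apply: csub_inj.
    case: Tiso => [[_ [_ Tl] _ _] _].
    by rewrite TE Tl -!TE.
  rewrite TE -[csub_val (_ + _)]/(k *: csub_val h + csub_val h') (iso_lin Tiso).
  by rewrite -!TE.
- move=> x h y k.
  rewrite -[LHS]/(inner (csub_val (restr (T x) h)) (csub_val (restr (T y) k))).
  rewrite !TE (iso_inner Tiso).
  rewrite -[RHS]/(inner (csub_val h) (csub_val (restr (sigma (cinner x y)) k))).
  by rewrite restrE//; exact: Nsig.
- apply: total_of_orth => x x0; apply: csub_inj; apply: dN.
    exact/set_mem/csub_in.
  move=> xi h Nh.
  have := x0 (restr (T xi) (CSub (mem_set Nh))).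
  rewrite -[inner _ x]/(inner (csub_val (restr (T xi) (CSub (mem_set Nh)))) (csub_val x)).
  by rewrite TE; apply; exists xi => //; exists (CSub (mem_set Nh)).
- by split=> //; move=> x; exact: cvg_id.
Qed.

Lemma coisometric_sub M N : cset M `<=` cset N ->
  reduces sigma T N -> reduces sigma T M ->
  restr_fully_coisometric sigma T N -> restr_fully_coisometric sigma T M.
Proof.
move=> MN rN rM /(range_dense_of_coisometric rN) dN.
apply: (coisometric_of_range_dense rM) => x Mx x0; apply: (dN x (MN _ Mx)) => xi h _.
have [P PP] := orth_projection_exists M; have [_ PT] := reduces_proj Tiso rM PP.
rewrite -(proj_id PP Mx) -(proj_sym PP) PT.
by apply: x0; exact: proj_in PP _.
Qed.

Lemma induced_sub M N : cset M `<=` cset N ->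
  reduces sigma T N -> reduces sigma T M ->
  restr_induced sigma T N -> restr_induced sigma T M.
Proof.
move=> MN rN rM /(framed_of_induced (reduces_invariant Tiso rN)) fN.
apply: induced_of_framed; last exact: framed_sub fN.
- by case: sigs.
- exact: (iso_bounded Tiso).
- exact: (reduces_invariant Tiso rM).
Qed.

Section Commutant.
Context (G : H -> H) (Gsym : forall x y, inner (G x) y = inner x (G y)).
Context (GT : forall xi h, G (T xi h) = T xi (G h)).

(** Induction on [m]: the adjoint of [T xi] maps [D_(m+1)^perp] into [D_m^perp], so [G y] is
    orthogonal to all [T xi h] with [h] in [N], and density kills its component in [N]. *)
Lemma range_dense_orth N m x y : reduces sigma T N -> range_dense N ->
  cset N x -> orthocomp (range_power T m) y -> inner (G x) y = 0.
Proof.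
move=> rN dN; elim: m x y => [|m IH] x y Nx oy.
  by rewrite (@orthocomp_self _ _ [set: H] y)// inner0r.
have [P PP] := orth_projection_exists N; have [_ PT] := reduces_proj Tiso rN PP.
have [T' T'P] := iso_adjoint Tiso.
have y0 : P (G y) = 0.
  apply: dN => [|xi h Nh]; first exact: proj_in PP _.
  rewrite -(proj_sym PP) PT (proj_id PP Nh) -Gsym GT T'P.
  apply: IH => // d md; rewrite -T'P.
  by apply: oy; exists xi => //; exists d.
by rewrite Gsym -(proj_id PP Nx) (proj_sym PP) y0 inner0r.
Qed.

Lemma coisometric_induced_orth M N x y :
  reduces sigma T M -> restr_induced sigma T M ->
  reduces sigma T N -> restr_fully_coisometric sigma T N ->
  cset N x -> cset M y -> inner (G x) y = 0.
Proof.
move=> rM /(framed_of_induced (reduces_invariant Tiso rM)).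
move=> [F [K [pi [tau fr]]]] rN /(range_dense_of_coisometric rN) dN Nx My.
have [P PP] := orth_projection_exists M.
suff Gx0 : P (G x) = 0 by rewrite -(proj_id PP My) -(proj_sym PP) Gx0 inner0l.
apply: (frame_orth fr) => [|m z k]; first exact: proj_in PP _.
rewrite -(proj_sym PP) (proj_id PP); last exact: frame_in fr _ _.
apply: inner_eq0C; apply: (range_dense_orth rN dN Nx).
exact: (frame_wandering Tiso fr rM).
Qed.

End Commutant.

End Reducing.

(** * Complements of reducing subspaces *)

Section Complement.
Context {R : realType} {A : cstarType R} (H : hilbertType R) (M N : csubspace H).
Hypothesis MN : forall x y, cset M x -> cset N y -> inner x y = 0.
Hypothesis MN_sum : forall h, exists x y, [/\ cset M x, cset N y & h = x + y].

Lemma complement_inr z : cset N z <-> orthocomp (cset M) z.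
Proof.
split=> [Nz x Mx|oz]; first exact: MN.
have [x [y [Mx Ny zE]]] := MN_sum z.
suff x0 : x = 0 by rewrite zE x0 add0r.
by apply: inner_self_eq0; have := oz x Mx; rewrite zE innerDr (MN Mx Ny) addr0.
Qed.

Lemma complement_inl z : cset M z <-> orthocomp (cset N) z.
Proof.
split=> [Mz y Ny|oz]; first exact/inner_eq0C/MN.
have [x [y [Mx Ny zE]]] := MN_sum z.
suff y0 : y = 0 by rewrite zE y0 addr0.
apply: inner_self_eq0; have := oz y Ny.
by rewrite zE innerDr (inner_eq0C (MN Mx Ny)) add0r.
Qed.

Lemma reduces_complement (E : corrType A) (sigma : A -> H -> H) (T : E -> H -> H) :
  star_rep sigma -> reduces sigma T M -> reduces sigma T N.
Proof.
move=> sigs [[P PP Psig] MT MT']; split.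
- exists (fun h => h - P h).
    move=> h; split; first by apply/complement_inr => k; exact: proj_orth PP _ _.
    by rewrite subKr; apply/complement_inl/(proj_in PP).
  by move=> a h; rewrite Psig (linB (srep_lin sigs a)).
- by move=> xi h /complement_inr oh; apply/complement_inr; exact: MT'.
- by move=> xi h /complement_inl Mh; apply/complement_inl; exact: MT.
Qed.

End Complement.

(** * Pairing subsets that differ in one given index *)

Section Toggle.
Context {I : finType} (k : I).
Implicit Types B : {set I}.

Definition toggle B : {set I} := if k \in B then B :\ k else k |: B.

Lemma in_toggle B i : (i \in toggle B) = if i == k then k \notin B else i \in B.
Proof.
rewrite /toggle; case: ifPn => kB; rewrite !inE.
  by case: eqP => [->|].
by case: eqP => [->|].
Qed.

Lemma toggleK : involutive toggle.
Proof.
move=> B; apply/setP => i; rewrite !in_toggle.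
by case: eqP => [->|//]; rewrite eqxx negbK.
Qed.

Lemma sum_toggle (V : zmodType) (F : {set I} -> V) :
  \sum_B F B = \sum_(B : {set I} | k \in B) (F B + F (toggle B)).
Proof.
rewrite big_split /= (bigID (fun B : {set I} => k \in B)) /=; congr (_ + _).
rewrite (reindex_inj (inv_inj toggleK)) /=.
by apply: eq_bigl => B; rewrite in_toggle eqxx negbK.
Qed.

End Toggle.

(** * Wold decompositions of the family *)

Section Family.
Context {R : realType} {A : cstarType R} (n : nat) (E : 'I_n -> corrType A).
Context (H : hilbertType R) (sigma : A -> H -> H).
Context (T : forall i : 'I_n, E i -> H -> H) (H1 H2 : 'I_n -> csubspace H).
Arguments T : clear implicits.
Hypothesis Tiso : forall i, isometric_rep sigma (T i).
Hypothesis sigs : star_rep sigma.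
Hypothesis dec : forall i, muhly_solel_decomposition sigma (T i) (H1 i) (H2 i).

Let H12 i x y : cset (H1 i) x -> cset (H2 i) y -> inner x y = 0.
Proof. by have [[h _] _ _ _] := dec i; exact: h. Qed.
Let Hsum i h : exists x y, [/\ cset (H1 i) x, cset (H2 i) y & h = x + y].
Proof. by have [[_ s] _ _ _] := dec i; exact: s. Qed.
Let in2 i z : cset (H2 i) z <-> orthocomp (cset (H1 i)) z.
Proof. exact: complement_inr (@H12 i) (Hsum i) z. Qed.
Let in1 i z : cset (H1 i) z <-> orthocomp (cset (H2 i)) z.
Proof. exact: complement_inl (@H12 i) (Hsum i) z. Qed.

Lemma reduces_H1_H2 i j :
  reduces sigma (T j) (H1 i) <-> reduces sigma (T j) (H2 i).
Proof.
split; first exact: reduces_complement (@H12 i) (Hsum i) _ _ _ sigs.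
apply: (reduces_complement (M := H2 i)) => //.
  by move=> x y Hx Hy; exact: (inner_eq0C (H12 Hy Hx)).
by move=> h; have [x [y [Hx Hy ->]]] := Hsum i h; exists y, x; rewrite addrC.
Qed.

Lemma reduces_of_wold : wold_decomposition sigma T ->
  forall i j, reduces sigma (T j) (H1 i).
Proof.
move=> [HA [[HAo HAs] HAr HAi HAc]] i j.
have [_ [r1 r2] i1 c2] := dec i.
(* Here the commuting operator [G] is the identity. *)
have ortho M N x y := @coisometric_induced_orth _ _ _ _ _ _ (Tiso i) id
  (fun _ _ => erefl) (fun _ _ => erefl) M N x y.
have sub1 (B : {set 'I_n}) x : i \in B -> cset (HA B) x -> cset (H1 i) x.
  move=> iB Bx; apply/in1 => y y2.
  exact: (ortho _ _ _ _ (HAr B i) (HAi B i iB) r2 c2).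
have sub2 (B : {set 'I_n}) x : i \notin B -> cset (HA B) x -> cset (H2 i) x.
  move=> iB Bx; apply/in2 => y y1; apply: inner_eq0C.
  exact: (ortho _ _ _ _ r1 i1 (HAr B i) (HAc B i iB)).
have split h : exists2 x, forall B, cset (HA B) (x B) &
    [/\ h = \sum_(B : {set 'I_n} | i \in B) x B + \sum_(B : {set 'I_n} | i \notin B) x B,
    cset (H1 i) (\sum_(B : {set 'I_n} | i \in B) x B) &
    cset (H2 i) (\sum_(B : {set 'I_n} | i \notin B) x B)].
  have [x xB ->] := HAs h; exists x => //; split.
  - exact: bigID.
  - by apply: cset_sum => B iB; exact: sub1 (xB B).
  - by apply: cset_sum => B iB; exact: sub2 (xB B).
have Tl xi : linear_map (T j xi) := iso_lin (Tiso j) xi.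
have HT B xi x : cset (HA B) x -> cset (HA B) (T j xi x).
  by have [_ h _] := HAr B j; exact: h.
have Tsum xi (P : pred {set 'I_n}) (x : {set 'I_n} -> H) :
    T j xi (\sum_(B | P B) x B) = \sum_(B | P B) T j xi (x B).
  exact: (big_morph (T j xi) (linD (Tl xi)) (lin0 (Tl xi))).
split; first by case: r1.
- move=> xi h h1; have [x xB [hE s1 s2]] := split h.
  (* This part of [h] lies in [H2 i], and also in [H1 i] as a difference of two vectors of
     [H1 i]. *)
  have s20 : \sum_(B : {set 'I_n} | i \notin B) x B = 0.
    apply: (@orthocomp_self _ _ (cset (H2 i))) => //; apply/in1.
    have -> : \sum_(B : {set 'I_n} | i \notin B) x B =
      h - \sum_(B : {set 'I_n} | i \in B) x B by rewrite hE addrAC subrr add0r.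
    exact: csetB.
  rewrite hE s20 addr0 Tsum; apply: cset_sum => B iB.
  by apply: (sub1 B) => //; exact: HT.
- move=> xi h /in2 h2; apply/in2; have [x xB [hE s1 s2]] := split h.
  have s10 : \sum_(B : {set 'I_n} | i \in B) x B = 0.
    apply: (@orthocomp_self _ _ (cset (H1 i))) => //; apply/in2.
    have -> : \sum_(B : {set 'I_n} | i \in B) x B =
      h - \sum_(B : {set 'I_n} | i \notin B) x B by rewrite hE addrK.
    exact: csetB.
  rewrite hE s10 add0r Tsum; apply: cset_sum => B iB.
  by apply: (sub2 B) => //; exact: HT.
Qed.

(** * Atoms: joint ranges of the commuting projections *)

Section Converse.
Hypothesis H1red : forall i j, reduces sigma (T j) (H1 i).
Context (P : 'I_n -> H -> H) (PP : forall i, orth_projection (H1 i) (P i)).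

Definition atom_part (B : {set 'I_n}) i := if i \in B then H1 i else H2 i.

Let atom_proj (B : {set 'I_n}) i h := if i \in B then P i h else h - P i h.

(** Commutation of the projections, in the form used below: [P i] commutes with [T j], so it may be
    taken as [G], and it then preserves both summands for [j]. *)
Lemma proj_preserves i j (B : {set 'I_n}) x :
  cset (atom_part B j) x -> cset (atom_part B j) (P i x).
Proof.
have [_ PT] := reduces_proj (Tiso j) (H1red i j) (PP i).
have [_ [r1 r2] i1 c2] := dec j.
have o := coisometric_induced_orth (Tiso j) (proj_sym (PP i)) PT r1 i1 r2 c2.
rewrite /atom_part; case: ifP => _ Hx.
  apply/in1 => y y2; rewrite -(proj_sym (PP i)); exact: o.
by apply/in2 => y y1; apply/inner_eq0C/o.
Qed.

Lemma atom_proj_in B i h : cset (atom_part B i) (atom_proj B i h).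
Proof.
rewrite /atom_part /atom_proj; case: ifP => _; first exact: proj_in (PP i) _.
by apply/in2 => k; exact: proj_orth (PP i) _ _.
Qed.

Lemma atom_proj_preserves B i j x :
  cset (atom_part B j) x -> cset (atom_part B j) (atom_proj B i x).
Proof.
move=> Hx; rewrite /atom_proj; case: ifP => _; first exact: proj_preserves.
by apply: csetB => //; exact: proj_preserves.
Qed.

(** Indices are treated one at a time: after [m] steps, [x B] lies in the prescribed summand for
    each index below [m]. *)
Lemma atom_sum h : exists2 x : {set 'I_n} -> H,
  forall B i, cset (atom_part B i) (x B) & h = \sum_B x B.
Proof.
suff /(_ n (leqnn n))[x xP hE] : forall m, (m <= n)%N ->
    exists2 x : {set 'I_n} -> H, forall B (i : 'I_n), (i < m)%N ->
      cset (atom_part B i) (x B) & h = \sum_B x B.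
  by exists x => // B i; apply: xP; exact: ltn_ord.
elim=> [_|m IH mn].
  (* Nothing is required at stage 0, so all of [h] is placed at the empty set. *)
  exists (fun B : {set 'I_n} => if B == finset.set0 then h else 0) => //.
  by rewrite -big_mkcond big_pred1_eq.
(* [B] and [toggle k B] obey the same conditions below [m], so their vectors are added and the sum
   is split anew by [P k] and its complement. *)
have [x xP ->] := IH (ltnW mn); pose k := Ordinal mn.
pose y B := x B + x (toggle k B).
have yP B (i : 'I_n) : (i < m)%N -> cset (atom_part B i) (y B).
  move=> im; apply: csetD; first exact: xP.
  have -> : atom_part B i = atom_part (toggle k B) i.
    rewrite /atom_part in_toggle; case: eqP => // ik.
    by move: im; rewrite ik /= ltnn.
  exact: xP.
have yt B : y (toggle k B) = y B by rewrite /y toggleK addrC.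
exists (fun B => atom_proj B k (y B)).
  move=> B i; rewrite ltnS leq_eqVlt => /orP[/eqP ik|im].
    by have -> : i = k; [exact: val_inj | exact: atom_proj_in].
  by apply: atom_proj_preserves; exact: yP.
rewrite (sum_toggle k) [RHS](sum_toggle k); apply: eq_bigr => B kB.
by rewrite yt /atom_proj in_toggle eqxx kB /= [RHS]addrC subrK.
Qed.

Lemma atom_closed_linear B : closed_linear [set h | forall i, cset (atom_part B i) h].
Proof.
split.
- rewrite (_ : [set _ | _] = \bigcap_(i in [set: 'I_n]) cset (atom_part B i)).
    by apply: closed_bigI => i _; exact: cset_closed.
  by apply/seteqP; split=> h /=; [move=> hh i _; exact: hh | move=> hh i; exact: hh].
- by move=> i; exact: cset0.
- by move=> c x y hx hy i; exact: csetP.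
Qed.

Definition atom B : csubspace H := closed_linear_csub (atom_closed_linear B).

Lemma atomE B h : cset (atom B) h <-> forall i, cset (atom_part B i) h.
Proof. by rewrite /atom closed_linear_csubE. Qed.

Lemma atom_orth B B' x y : B != B' -> cset (atom B) x -> cset (atom B') y ->
  inner x y = 0.
Proof.
move=> BB' /atomE hx /atomE hy.
have [i iBB'] : exists i, (i \in B) != (i \in B').
  apply/existsP; apply: contraNT BB'; rewrite negb_exists => /forallP h.
  by apply/eqP/setP => i; have := h i; rewrite negbK => /eqP.
move: (hx i) (hy i) iBB'; rewrite /atom_part.
case: (i \in B); case: (i \in B') => // h h' _; first exact: H12 h h'.
exact: (inner_eq0C (H12 h' h)).
Qed.

Lemma atom_reduces B j : reduces sigma (T j) (atom B).
Proof.
have Qred i : reduces sigma (T j) (atom_part B i).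
  by rewrite /atom_part; case: ifP => _; [|apply/reduces_H1_H2]; exact: H1red.
have inv a h : cset (atom B) h -> cset (atom B) (sigma a h).
  move=> /atomE hB; apply/atomE => i.
  by have [h' _] := reduces_invariant (Tiso j) (Qred i); exact: h'.
have Tinv C xi h : cset (atom C) h -> cset (atom C) (T j xi h).
  move=> /atomE hB; apply/atomE => i; move: (hB i); rewrite /atom_part.
  have [_ m1 _] := H1red i j; have /reduces_H1_H2[_ m2 _] := H1red i j.
  by case: ifP => _; [exact: m1 | exact: m2].
split.
- have [Q QQ] := orth_projection_exists (atom B); exists Q => // a h.
  apply: (proj_commute QQ); [exact: srep_lin sigs a | exact: inv |].
  by move=> k ok l Bl; rewrite (srep_adjr sigs); apply: ok; exact: inv.
- by move=> xi h; exact: Tinv.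
(* The component of [h] in [atom B] vanishes; the other components stay in their own atoms under
   [T j xi], hence orthogonal to [atom B]. *)
- move=> xi h oh k Bk; have [x xP hE] := atom_sum h.
  have xA C : cset (atom C) (x C) by apply/atomE => i; exact: xP.
  have xB0 : x B = 0.
    apply: inner_self_eq0; have := oh _ (xA B).
    rewrite hE inner_sumr (bigD1 B) //= big1 ?addr0// => C CB.
    by apply: atom_orth (xA B) (xA C); rewrite eq_sym.
  rewrite hE (lin_sum (iso_lin (Tiso j) xi)) inner_sumr big1// => C _.
  have [->|CB] := eqVneq C B.
    by rewrite xB0 (lin0 (iso_lin (Tiso j) xi)) inner0r.
  by apply: atom_orth Bk (Tinv _ _ _ (xA C)); rewrite eq_sym.
Qed.

Lemma wold_of_atoms : wold_decomposition sigma T.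
Proof.
exists atom; split.
- split=> [B B' x y|h]; first exact: atom_orth.
  have [x xP hE] := atom_sum h; exists x => // B; apply/atomE => i; exact: xP.
- exact: atom_reduces.
- move=> B i iB; have [_ [r1 _] i1 _] := dec i.
  apply: (induced_sub (Tiso i) _ r1 (atom_reduces B i) i1) => h /atomE/(_ i).
  by rewrite /atom_part iB.
- move=> B i iB; have [_ [_ r2] _ c2] := dec i.
  apply: (coisometric_sub (Tiso i) _ r2 (atom_reduces B i) c2) => h /atomE/(_ i).
  by rewrite /atom_part (negPf iB).
Qed.

End Converse.

Lemma wold_of_reduces : (forall i j, reduces sigma (T j) (H1 i)) ->
  wold_decomposition sigma T.
Proof.
move=> H1red.
have /choice[P PP] : forall i, exists P, orth_projection (H1 i) P.
  by move=> i; exact: orth_projection_exists.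
exact: (wold_of_atoms H1red PP).
Qed.

End Family.

Unset Implicit Arguments.

Theorem theorem3p2 (R : realType) (A : cstarType R) (n : nat)
    (E : 'I_n -> corrType A) (H : hilbertType R) (sigma : A -> H -> H)
    (T : forall i : 'I_n, E i -> H -> H) (H1 H2 : 'I_n -> csubspace H) :
  separable H ->
  (forall i, nondegenerate_action (@lact R A (E i))) ->
  nondegenerate_rep sigma ->
  (forall i, isometric_rep sigma (T i)) ->
  (forall i, muhly_solel_decomposition sigma (T i) (H1 i) (H2 i)) ->
  (wold_decomposition sigma T <->
     (forall i j, reduces sigma (T j) (H1 i))) /\
  (wold_decomposition sigma T <->
     (forall i j, reduces sigma (T j) (H2 i))).
Proof.
move=> _ _ [sigs _] Tiso dec.
have main : wold_decomposition sigma T <-> (forall i j, reduces sigma (T j) (H1 i)).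
  by split; [exact: reduces_of_wold | exact: wold_of_reduces].
have H12 i j := reduces_H1_H2 sigs dec i j.
split=> //; split=> [/main r i j|r]; first exact/H12.
by apply/main => i j; exact/H12.
Qed.
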